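(* Let $P,\Lambda,\sigma^2,\sigma_S^2>0$. The capacity (randomized coding capacity under the maximum probability of error criterion) of the Dirty Paper AVC with encoder power constraint $P$, adversary power constraint $\Lambda$, noise variance $\sigma^2$ and state variance $\sigma_S^2$ is $$C=\frac12\log\left(1+\frac{P}{\Lambda+\sigma^2}\right).$$
   Context: All logarithms are base 2; $\|\cdot\|$ is the Euclidean norm on $\mathbb R^n$. Dirty Paper AVC (DP-AVC). Over $n$ channel uses the decoder receives $\mathbf Y=\mathbf X+\mathbf S+\mathbf J+\mathbf Z\in\mathbb R^n$, where $\mathbf X$ is the encoder's input, the state $\mathbf S$ has i.i.d. $\mathcal N(0,\sigma_S^2)$ components, $\mathbf J$ is the adversary's input, and the noise $\mathbf Z$ has i.i.d. $\mathcal N(0,\sigma^2)$ components and is independent of everything else. $\mathbf S$ is independent of the message $M$ and of the shared randomness. The decoder does not know $\mathbf S$. An $(n,R,P)$ deterministic code ($2^{nR}$ an integer) is a pair $(\psi,\phi)$ of (measurable) maps $\psi:\{1,\dots,2^{nR}\}\times\mathbb R^n\to\mathbb R^n$ with $\|\psi(m,\mathbf s)\|^2\le nP$ for all $m,\mathbf s$, and $\phi:\mathbb R^n\to\{0,1,\dots,2^{nR}\}$ (output $0$ means an error is declared). An $(n,R,P)$ randomized code is a random variable $\Theta=(\Psi,\Phi)$ taking values in the set of $(n,R,P)$ deterministic codes; it is shared by encoder and decoder. The transmitted vector is $\mathbf X=\Psi(M,\mathbf S)$. The adversary knows $M$, $\mathbf S$ (non-causally) and the distribution of $\Theta$, but not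 its realization: it chooses $\mathbf J$ by an arbitrary conditional distribution $Q_{\mathbf J|M,\mathbf S}$ supported on $\mathcal J(\Lambda)=\{\mathbf j\in\mathbb R^n:\|\mathbf j\|^2\le n\Lambda\}$, with $\mathbf J$ conditionally independent of $\Theta$ given $(M,\mathbf S)$. The maximum probability of error is $$P_e^{(n)}=\max_m\ \max_{Q_{\mathbf J|M=m,\mathbf S}:\,\mathbf J\in\mathcal J(\Lambda)}\mathbb P(\Phi(\mathbf Y)\neq m\mid M=m)$$ (the inner maximum being understood as a supremum), the probability being over $\mathbf S$, $\mathbf J$, $\mathbf Z$ and $\Theta$. A rate $R$ is achievable if for every $\epsilon>0$ there is an $(n,R,P)$ randomized code for some $n$ with $P_e^{(n)}<\epsilon$. The capacity is the supremum of all achievable rates. *)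

(* Defs.v *)
From HB Require Import structures.
From mathcomp Require Import all_boot all_order all_algebra.
From mathcomp Require Import all_classical all_reals all_analysis.

Set Implicit Arguments.
Unset Strict Implicit.
Unset Printing Implicit Defensive.

Import Order.TTheory GRing.Theory Num.Theory.
Import numFieldNormedType.Exports.

Local Open Scope classical_set_scope.
Local Open Scope ring_scope.

(* Vectors of R^n are [n.-tuple R], which the library equips with the product
   (Borel) sigma-algebra. *)

Section vectors.
Context {R : realType}.

Definition vadd n (x y : n.-tuple R) : n.-tuple R :=
  [tuple tnth x i + tnth y i | i < n].

(* The squared Euclidean norm (the library's norm on ['rV[R]_n] is the sup
   norm). *)
Definition sqnorm n (x : n.-tuple R) : R := \sum_(i < n) tnth x i ^+ 2.

Definition log2 (x : R) : R := ln x / ln 2.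

End vectors.

Section iid.
Context d (T : measurableType d) (R : realType).

Definition tcons n (p : T * n.-tuple T) : n.+1.-tuple T :=
  [tuple of p.1 :: p.2].

Lemma measurable_tcons n : measurable_fun [set: T * n.-tuple T] (@tcons n).
Proof. exact: measurable_cons. Qed.

HB.instance Definition _ n :=
  isMeasurableFun.Build _ _ _ _ (@tcons n) (@measurable_tcons n).

Local Open Scope ereal_scope.

(* The law of [n] i.i.d. samples of [mu], as characterized by [iid_probE]. *)
Fixpoint iid_prob (mu : probability T R) n : probability (n.-tuple T) R :=
  if n is n'.+1
  then distribution (mu \x iid_prob mu n' : probability _ R) (@tcons n')
  else \d_([tuple] : 0.-tuple T).

Lemma iid_probE (mu : probability T R) n (A : 'I_n -> set T) :
  (forall i, measurable (A i)) ->
  iid_prob mu n [set x | forall i, A i (tnth x i)] = \prod_(i < n) mu (A i).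
Proof.
elim: n A => [|n IHn] A mA.
  by rewrite big_ord0 /= diracE mem_set// => -[].
rewrite big_ord_recl /= /distribution /pushforward /=.
rewrite -IHn => [|i]; last exact: mA.
rewrite -product_measure1E//=.
- congr (_ _); apply/seteqP; split=> -[t x] /= H.
    split=> [|i]; first by have := H ord0; rewrite tnth0.
    by have := H (lift ord0 i); rewrite tnthS.
  move=> i; case: (unliftP ord0 i) => [j ->|->].
    by rewrite tnthS; exact: H.2.
  by rewrite tnth0; exact: H.1.
- have -> : [set x : n.-tuple T | forall i, A (lift ord0 i) (tnth x i)] =
      \big[setI/setT]_(i < n) ((@tnth n T)^~ i @^-1` A (lift ord0 i)).
    apply/seteqP; split=> x /=.
      by move=> xA; elim/big_ind : _ => //= B C Bx Cx; split.
    move=> + i; rewrite (bigD1 i)//= => -[]//.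
  apply: bigsetI_measurable => i _; rewrite -[X in measurable X]setTI.
  exact: measurable_tnth.
Qed.

End iid.

Section dirty_paper_avc.
Local Open Scope ereal_scope.
Context {R : realType}.

(* A deterministic code of block length [n] with [K] messages and encoder power
   constraint [P]; [None] is the decoder output that declares an error. *)
Record det_code (n K : nat) (P : R) := DetCode {
  enc : 'I_K -> n.-tuple R -> n.-tuple R ;
  dec : n.-tuple R -> option 'I_K ;
  measurable_enc : forall m, measurable_fun setT (enc m) ;
  measurable_dec : forall m, measurable [set y | dec y = m] ;
  enc_power : forall m s, (sqnorm (enc m s) <= n%:R * P)%R }.

(* A randomized code is a random variable [rc_code] valued in the deterministic
   codes, on an arbitrary probability space. Its measurability is joint
   measurability of the encoder in (randomness, state) and of the decoder in
   (randomness, channel output). *)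
Record rand_code (n K : nat) (P : R) := RandCode {
  rc_disp : measure_display ;
  rc_space : measurableType rc_disp ;
  rc_law : probability rc_space R ;
  rc_code : rc_space -> det_code n K P ;
  measurable_rc_enc : forall m,
    measurable_fun setT (fun ws : rc_space * n.-tuple R =>
      enc (rc_code ws.1) m ws.2) ;
  measurable_rc_dec : forall m,
    measurable [set wy : rc_space * n.-tuple R | dec (rc_code wy.1) wy.2 = m] }.
Arguments rc_code {n K P} Theta w : rename.

Definition power_ball n (L : R) : set (n.-tuple R) :=
  [set j | (sqnorm j <= n%:R * L)%R].

(* The library puts [normal_prob] on [measurableTypeR R], a copy of [R] with the
   same measurable sets but another display; [to_real] transports it to [R]. *)
Definition to_real : measurableTypeR R -> R := idfun.

Lemma measurable_to_real : measurable_fun setT to_real.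
Proof. exact: (@measurable_id _ (measurableTypeR R) setT). Qed.

HB.instance Definition _ :=
  isMeasurableFun.Build _ _ _ _ to_real measurable_to_real.

Definition gauss (sigma : R) : probability R R :=
  distribution (normal_prob 0 sigma : probability (measurableTypeR R) R) to_real.

Lemma gaussE (sigma : R) (A : set R) : gauss sigma A = normal_prob 0 sigma A.
Proof. by []. Qed.

(* [gauss_vec n sigma] has i.i.d. N(0, sigma^2) components: [sigma] is the
   standard deviation. *)
Definition gauss_vec n (sigma : R) : probability (n.-tuple R) R :=
  iid_prob (gauss sigma) n.

(* The probability of error for message [m] when the adversary draws J from
   [Q s] upon observing the state [s]. The joint law of (Theta, S, J, Z) is
   law(Theta)(dw) N(0, sigmaS^2 I)(ds) Q(s, dj) N(0, sigma^2 I)(dz): Theta, S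
   and Z are independent, and J is independent of Theta given S. *)
Definition error_prob n K P (sigma sigmaS : R) (Theta : rand_code n K P)
    (m : 'I_K) (Q : R.-pker n.-tuple R ~> n.-tuple R) : \bar R :=
  \int[rc_law Theta]_w \int[gauss_vec n sigmaS]_s \int[Q s]_j
    gauss_vec n sigma
      [set z | let x := enc (rc_code Theta w) m s in
        dec (rc_code Theta w) (vadd (vadd (vadd x s) j) z) <> Some m].

Definition max_error_prob n K P (L sigma sigmaS : R)
    (Theta : rand_code n K P) : \bar R :=
  \big[maxe/-oo]_(m < K)
    ereal_sup [set error_prob sigma sigmaS Theta m Q
              | Q in [set Q : R.-pker n.-tuple R ~> n.-tuple R |
                       forall s, Q s (power_ball L) = 1]].

Definition achievable (P L sigma sigmaS rate : R) : Prop :=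
  forall eps : R, (0 < eps)%R ->
    exists n K : nat,
      [/\ (0 < n)%N, (K%:R = 2 `^ (n%:R * rate) :> R)%R &
        exists Theta : rand_code n K P,
          max_error_prob L sigma sigmaS Theta < eps%:E].

Definition capacity (P L sigma sigmaS : R) : \bar R :=
  ereal_sup [set rate%:E | rate in achievable P L sigma sigmaS].

End dirty_paper_avc.

Arguments rc_code {R n K P} Theta w : rename.

(* Main.v *)
(** Converse. Let the adversary send Gaussian noise of variance slightly below
    [L], truncated to the power ball. A decoder that even knows the state faces
    a Gaussian channel with noise variance [w], close to [L + sigma^2], and is
    compared by hypothesis testing with the output law [N(0, P + w)]: a Renyi
    moment of the likelihood ratio bounds the success probabilities summed over
    the messages. As [achievable] asks for one block length per [eps], the short
    ones are excluded separately: without jamming, all output laws dominate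
    [c^n] times a common Gaussian law, so two messages cannot both be decoded
    well.

    Achievability. Put [N = L + sigma^2] and [al = P / (P + N)] and draw
    the codewords [u] uniformly in the torus [R^n / (b Z)^n]. The encoder sends
    [X = [u - al S]] for a codeword [u] of its message that makes [|X|^2 <= n P],
    where [[.]] reduces to the cube of side [b]; the decoder looks for
    codewords with [|[u - al Y]|^2 <= n eta]. For the sent codeword,
    [u - al Y] is congruent to [(1 - al) X - al V] with [V = J + Z]; this is too
    long only if [X] lies in a cap of the power ball, of exponentially small
    relative volume, and a codeword of another message is accepted with
    relative probability [(eta / P)^(n/2)], where [eta] is close to
    [P N / (P + N) = P 2^(-2 C)]. By shift invariance of the torus this holds
    for every state and every jamming vector, whatever their dependence. *)

Require Import Defs.
From HB Require Import structures.
From mathcomp Require Import all_boot all_order all_algebra.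
From mathcomp Require Import all_classical all_reals all_analysis.
From mathcomp Require Import measurable_realfun interval_inference zify ring lra.

Set Implicit Arguments.
Unset Strict Implicit.
Unset Printing Implicit Defensive.

Import Order.TTheory GRing.Theory Num.Theory.
Import numFieldNormedType.Exports.

Local Open Scope classical_set_scope.
Local Open Scope ring_scope.

Local Open Scope ereal_scope.

(** * Integration against i.i.d. laws *)

(** On the torus the only geometric fact used is how the probability of a ball scales with its
    radius. Its value [p] is never estimated: about [n / p] codewords per message reduce every bound
    to a ratio of two ball probabilities. The law of the selected codeword is not computed either.
    If it lies in the bad cap, then some codeword of the message lies in a smaller ball whose centre
    is fixed by the state and by [V], and a union bound over the codebook costs only a factor
    [n + 1]. Since [J] is independent of the code given the state, all this happens with [S], [J]
    and [Z] frozen, under the law of the code alone. The coefficient [al] is the one that minimises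
    [(1 - al)^2 P + al^2 N]; the minimum is [P N / (P + N)]. In the converse every estimate is made
    for a fixed deterministic code and a fixed state, so that code randomness and state are averaged
    out only at the end. The sum over messages is affordable because the disjoint decision regions
    are all measured by one and the same output law. *)

Lemma measurable_tuple d1 d2 (T1 : measurableType d1) (T2 : measurableType d2)
    n (f : 'I_n -> T1 -> T2) :
  (forall i, measurable_fun [set: T1] (f i)) ->
  measurable_fun [set: T1] (fun x => [tuple f i x | i < n]).
Proof.
move=> mf; apply/measurable_fun_tnthP => i.
rewrite (_ : _ \o _ = f i)//; apply/funext => x /=; exact: tnth_mktuple.
Qed.

Lemma measurable_fun_bigprod d (T : measurableType d) (R : realType) (I : Type)
    (r : seq I) (f : I -> T -> R) :
  (forall i, measurable_fun [set: T] (f i)) ->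
  measurable_fun [set: T] (fun x => \prod_(i <- r) f i x)%R.
Proof.
move=> mf; elim: r => [|i r IHr].
  by under eq_fun do rewrite big_nil; exact: measurable_cst.
by under eq_fun do rewrite big_cons; exact: measurable_funM.
Qed.

Section iid_integral.
Context d (T : measurableType d) (R : realType).
Implicit Types mu : probability T R.

Lemma measurable_tcons_pair d1 (T1 : measurableType d1) n (f : T1 -> T)
    (g : T1 -> n.-tuple T) :
  measurable_fun [set: T1] f -> measurable_fun [set: T1] g ->
  measurable_fun [set: T1] (fun x => tcons (f x, g x)).
Proof. by move=> mf mg; exact: measurable_cons. Qed.

Lemma integral_iid0 mu (F : 0.-tuple T -> \bar R) :
  measurable_fun [set: 0.-tuple T] F ->
  \int[iid_prob mu 0]_x F x = F [tuple].
Proof. by move=> mF /=; rewrite integral_dirac// diracT mul1e. Qed.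

Lemma integral_iid_cons mu n (F : n.+1.-tuple T -> \bar R) :
  measurable_fun [set: n.+1.-tuple T] F -> (forall x, 0 <= F x) ->
  \int[iid_prob mu n.+1]_x F x =
  \int[mu]_t \int[iid_prob mu n]_x F (tcons (t, x)).
Proof.
move=> mF F0 /=.
rewrite ge0_integral_distribution// fubini_tonelli1//.
- exact: measurableT_comp.
- by move=> x; exact: F0.
Qed.

(* Simplification would otherwise expand [iid_prob] into product measures. *)
#[local] Opaque iid_prob.

Lemma integral_iid_prod mu n (h : 'I_n -> T -> R) (c : 'I_n -> R) :
  (forall i, measurable_fun [set: T] (h i)) -> (forall i x, (0 <= h i x)%R) ->
  (forall i, \int[mu]_x (h i x)%:E = (c i)%:E) ->
  \int[iid_prob mu n]_x (\prod_(i < n) h i (tnth x i))%:E =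
  (\prod_(i < n) c i)%:E.
Proof.
elim: n h c => [|n IHn] h c mh h0 hc.
  rewrite integral_iid0 ?big_ord0//.
  by under eq_fun do rewrite big_ord0; exact: measurable_cst.
have mprod : measurable_fun [set: n.-tuple T]
    (fun x => (\prod_(i < n) h (lift ord0 i) (tnth x i))%:E).
  apply/measurable_EFinP/measurable_fun_bigprod => i.
  by apply: measurableT_comp => //; exact: measurable_tnth.
rewrite integral_iid_cons; first last.
- by move=> x; rewrite lee_fin prodr_ge0.
- apply/measurable_EFinP/measurable_fun_bigprod => i.
  by apply: measurableT_comp => //; exact: measurable_tnth.
transitivity (\int[mu]_t ((h ord0 t)%:E *
    \int[iid_prob mu n]_x (\prod_(i < n) h (lift ord0 i) (tnth x i))%:E)).
  apply: eq_integral => t _; rewrite -ge0_integralZl//; last 2 first.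
    by move=> x _; rewrite lee_fin prodr_ge0.
    by rewrite lee_fin.
  apply: eq_integral => x _; rewrite big_ord_recl tnth0 -EFinM.
  by under eq_bigr do rewrite tnthS.
rewrite (IHn (fun i => h (lift ord0 i)) (fun i => c (lift ord0 i)))//.
rewrite ge0_integralZr//; last 3 first.
- exact/measurable_EFinP.
- by move=> x _; rewrite lee_fin.
- rewrite lee_fin prodr_ge0// => i _.
  by rewrite -lee_fin -hc integral_ge0// => x _; rewrite lee_fin.
by rewrite hc -EFinM big_ord_recl.
Qed.

Definition tupd n (x : n.-tuple T) (i : 'I_n) (u : T) : n.-tuple T :=
  [tuple if j == i then u else tnth x j | j < n].

Lemma measurable_tupd n (i : 'I_n) :
  measurable_fun [set: n.-tuple T * T] (fun xu => tupd xu.1 i xu.2).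
Proof.
apply: (measurable_tuple (f := fun j (xu : n.-tuple T * T) =>
  if j == i then xu.2 else tnth xu.1 j)) => j.
case: (j == i); first exact: measurable_snd.
apply: (measurableT_comp (f := fun x : n.-tuple T => tnth x j)) => //.
exact: measurable_tnth.
Qed.

Lemma tnth_tupd n (x : n.-tuple T) (i j : 'I_n) u :
  tnth (tupd x i u) j = if j == i then u else tnth x j.
Proof. by rewrite tnth_mktuple. Qed.

(** Coordinate [i] is independent of the others, so a fresh copy may replace it. This is how the
    independence of the codebooks of two messages enters. *)
Lemma integral_iid_resample mu n (i : 'I_n) (F : n.-tuple T -> \bar R) :
  measurable_fun [set: n.-tuple T] F -> (forall x, 0 <= F x) ->
  \int[iid_prob mu n]_x F x =
  \int[iid_prob mu n]_x \int[mu]_u F (tupd x i u).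
Proof.
elim: n i F => [[]//|n IHn] i F mF F0.
have mG : measurable_fun [set: n.+1.-tuple T]
    (fun x => \int[mu]_u F (tupd x i u)).
  apply: (measurable_fun_fubini_tonelli_F
    (fun xu : n.+1.-tuple T * T => F (tupd xu.1 i xu.2))) => //.
  by apply: measurableT_comp => //; exact: measurable_tupd.
rewrite (integral_iid_cons mu mF F0) (integral_iid_cons mu mG); last first.
  by move=> x; exact: integral_ge0.
case: (unliftP ord0 i) => [j|] ->.
  apply: eq_integral => t _.
  have mFt : measurable_fun [set: n.-tuple T] (fun x => F (tcons (t, x))).
    by apply: (measurableT_comp mF); exact: measurable_tcons_pair.
  rewrite (IHn j _ mFt (fun x => F0 _)).
  apply: eq_integral => x _; apply: eq_integral => u _; congr F.
  apply: eq_from_tnth => l; rewrite tnth_tupd.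
  case: (unliftP ord0 l) => [l'|] ->; last first.
    by rewrite !tnth0.
  by rewrite !tnthS tnth_tupd (inj_eq (@lift_inj _ ord0)).
pose G (x : n.-tuple T) := \int[mu]_u F (tcons (u, x)).
transitivity (\int[iid_prob mu n]_x G x).
  rewrite (fubini_tonelli (fun tx => F (tcons tx)))//.
  by apply: measurableT_comp.
transitivity (\int[mu]_t \int[iid_prob mu n]_x G x).
  by rewrite integral_cst//= probability_setT mule1.
apply: eq_integral => t _; apply: eq_integral => x _; apply: eq_integral => u _.
congr F; apply: eq_from_tnth => l; rewrite tnth_tupd.
case: (unliftP ord0 l) => [l'|] ->; last by rewrite eqxx tnth0.
by rewrite !tnthS.
Qed.

Lemma integral_iid_tnth mu n (i : 'I_n) (F : T -> \bar R) :
  measurable_fun [set: T] F -> (forall x, 0 <= F x) ->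
  \int[iid_prob mu n]_x F (tnth x i) = \int[mu]_x F x.
Proof.
move=> mF F0; rewrite (integral_iid_resample _ i)//; last first.
  by apply: measurableT_comp => //; exact: measurable_tnth.
under eq_integral => x _.
  under eq_integral do rewrite tnth_tupd eqxx.
  over.
by rewrite integral_cst//= probability_setT mule1.
Qed.

End iid_integral.

(** Densities of independent coordinates multiply: [h i] is the density with respect to [nu] of the
    image of [mu] under [k i]. It serves for Gaussian shifts, for translations of the torus
    ([h i = 1]) and for contractions of the torus. *)
Lemma integral_iid_transfer d1 d2 (T1 : measurableType d1)
    (T2 : measurableType d2) (R : realType)
    (mu : probability T1 R) (nu : probability T2 R) n
    (k : 'I_n -> T1 -> T2) (h : 'I_n -> T2 -> R) :
  (forall i, measurable_fun [set: T1] (k i)) ->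
  (forall i, measurable_fun [set: T2] (h i)) ->
  (forall i y, (0 <= h i y)%R) ->
  (forall i (F : T2 -> \bar R), measurable_fun [set: T2] F ->
    (forall y, 0 <= F y) ->
    \int[mu]_x F (k i x) = \int[nu]_y (F y * (h i y)%:E)) ->
  forall F : n.-tuple T2 -> \bar R, measurable_fun [set: n.-tuple T2] F ->
    (forall y, 0 <= F y) ->
    \int[iid_prob mu n]_x F [tuple k i (tnth x i) | i < n] =
    \int[iid_prob nu n]_y (F y * (\prod_(i < n) h i (tnth y i))%:E).
Proof.
elim: n k h => [|n IHn] k h mk mh h0 kh F mF F0.
  have F1 x : F x = F [tuple] by rewrite (tuple0 x) -(tuple0 [tuple]).
  under eq_fun do rewrite F1; under [in RHS]eq_fun do rewrite F1 big_ord0 mule1.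
  by rewrite !integral_iid0.
have mprod m (g : 'I_m -> T2 -> R) : (forall i, measurable_fun [set: T2] (g i)) ->
    measurable_fun [set: m.-tuple T2] (fun x => (\prod_(i < m) g i (tnth x i))%:E).
  move=> mg; apply/measurable_EFinP/measurable_fun_bigprod => i.
  by apply: measurableT_comp => //; exact: measurable_tnth.
rewrite integral_iid_cons//; last first.
  apply: measurableT_comp => //; apply: measurable_tuple => i.
  by apply: measurableT_comp => //; exact: measurable_tnth.
rewrite integral_iid_cons//; last 2 first.
- by apply: emeasurable_funM => //; exact: mprod.
- by move=> y; rewrite mule_ge0// lee_fin prodr_ge0.
pose H (y : n.-tuple T2) := (\prod_(i < n) h (lift ord0 i) (tnth y i))%:E.
have mH : measurable_fun [set: n.-tuple T2] H.
  exact: (mprod _ (fun i => h (lift ord0 i))).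
have H0 y : 0 <= H y by rewrite lee_fin prodr_ge0.
have mFH : measurable_fun [set: T2 * n.-tuple T2]
    (fun sy => F (tcons sy) * H sy.2).
  by apply: emeasurable_funM; apply: measurableT_comp.
pose G s := \int[iid_prob nu n]_y (F (tcons (s, y)) * H y).
have mG : measurable_fun [set: T2] G.
  apply: (measurable_fun_fubini_tonelli_F
    (fun sy : T2 * n.-tuple T2 => F (tcons sy) * H sy.2)) => //.
  by move=> sy; rewrite mule_ge0.
transitivity (\int[mu]_t G (k ord0 t)).
  apply: eq_integral => t _.
  rewrite /G -(IHn (fun i => k (lift ord0 i)) (fun i => h (lift ord0 i)))//; first last.
  - by apply: measurableT_comp => //; exact: measurable_tcons_pair.
  - by move=> i; exact: kh.
  apply: eq_integral => x _; congr F; apply: eq_from_tnth => l.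
  rewrite tnth_mktuple; case: (unliftP ord0 l) => [l'|] ->.
    by rewrite !tnthS tnth_mktuple.
  by rewrite !tnth0.
rewrite kh//; last by move=> y; apply: integral_ge0 => x _; rewrite mule_ge0.
apply: eq_integral => s _.
rewrite -ge0_integralZr//; last 3 first.
- apply: emeasurable_funM => //; apply: measurableT_comp => //.
  exact: measurable_tcons_pair.
- by move=> y _; rewrite mule_ge0.
- by rewrite lee_fin.
apply: eq_integral => y _; rewrite -muleA; congr (_ * _).
rewrite /H big_ord_recl tnth0 -EFinM mulrC; congr (_ * _)%:E.
by apply: eq_bigr => i _; rewrite tnthS.
Qed.

#[local] Opaque iid_prob.

(** * Gaussian and uniform laws on the line *)

Section density.
Context d (T : measurableType d) (R : realType).
Variables (mu nu : {measure set T -> \bar R}) (h : T -> R).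
Hypotheses (mh : measurable_fun [set: T] h) (h0 : forall x, (0 <= h x)%R).
Hypothesis nuE : forall A, measurable A -> nu A = \int[mu]_(x in A) (h x)%:E.
Import HBNNSimple.

Let ge0_integral_density_nnsfun (f : {nnsfun T >-> R}) :
  \int[nu]_x (f x)%:E = \int[mu]_x ((f x)%:E * (h x)%:E).
Proof.
under [LHS]eq_integral do rewrite fimfunE -fsumEFin//.
rewrite ge0_integral_fsum//; last 2 first.
- by move=> r; exact/measurable_EFinP/measurableT_comp.
- by move=> n x _; rewrite EFinM nnfun_muleindic_ge0.
under [RHS]eq_integral.
  move=> x _; rewrite fimfunE -fsumEFin// ge0_mule_fsuml; last first.
    by move=> r; rewrite EFinM nnfun_muleindic_ge0.
  over.
rewrite [RHS]ge0_integral_fsum//; last 2 first.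
- move=> r; apply: emeasurable_funM; last exact/measurable_EFinP.
  by apply/measurable_EFinP; do 2 apply/measurableT_comp => //.
- move=> r x _; apply: mule_ge0; last by rewrite lee_fin.
  by rewrite EFinM nnfun_muleindic_ge0.
apply: eq_fsbigr => r /[!inE] -[t _ <-] {r}.
rewrite integralZl_indic_nnsfun// integral_indic// setIT nuE//.
under [RHS]eq_integral do rewrite EFinM -muleA.
rewrite [RHS]ge0_integralZl//; last 3 first.
- by apply: emeasurable_funM => //; exact/measurable_EFinP.
- by move=> x _; rewrite mule_ge0// lee_fin.
- by rewrite lee_fin.
congr (_ * _); rewrite integral_mkcond; apply: eq_integral => x _.
by rewrite patchE indicE; case: ifP => _; rewrite ?mul1e ?mul0e.
Qed.

(** Monotone convergence from the case of simple functions. *)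
Lemma ge0_integral_density (f : T -> \bar R) :
  measurable_fun [set: T] f -> (forall x, 0 <= f x) ->
  \int[nu]_x f x = \int[mu]_x (f x * (h x)%:E).
Proof.
move=> mf f0; pose f_ := nnsfun_approx measurableT mf.
transitivity (limn (fun n => \int[nu]_x (f_ n x)%:E)).
  rewrite -monotone_convergence//=.
  - apply: eq_integral => x _; apply/esym/cvg_lim => //=.
    exact: cvg_nnsfun_approx.
  - by move=> n; exact/measurable_EFinP.
  - by move=> n x _; rewrite lee_fin.
  - by move=> x _ a b ab; rewrite lee_fin//; exact/lefP/nd_nnsfun_approx.
rewrite (_ : (fun n => _) =
    (fun n => \int[mu]_x ((f_ n x)%:E * (h x)%:E))); last first.
  by apply/funext => n; exact: ge0_integral_density_nnsfun.
rewrite -monotone_convergence//=.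
- apply: eq_integral => x _; apply/cvg_lim => //=.
  apply: cvgeZr => //; exact: cvg_nnsfun_approx.
- move=> n; apply: emeasurable_funM; exact/measurable_EFinP.
- by move=> n x _; rewrite mule_ge0// lee_fin.
- move=> x _ a b ab; rewrite lee_wpmul2r// lee_fin//.
  exact/lefP/nd_nnsfun_approx.
Qed.

End density.

Section lebesgue_affine.
Context {R : realType}.
Notation leb := (@lebesgue_measure R).

(** The image of Lebesgue measure under the affine map, scaled by [c], agrees with Lebesgue measure
    on half-open intervals, hence everywhere. *)
Lemma ge0_integral_affine (c a : R) (F : R -> \bar R) :
  (0 < c)%R -> measurable_fun [set: R] F ->
  (forall x, 0 <= F x) ->
  \int[leb]_x F x = c%:E * \int[leb]_x F (c * x + a)%R.
Proof.
move=> c0 mF F0.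
pose phi (x : measurableTypeR R) : measurableTypeR R := (c * x + a)%R.
have mphi : measurable_fun [set: measurableTypeR R] phi.
  by apply: measurable_funD => //; exact: measurable_funM.
have c0' : (0 <= c)%R := ltW c0.
pose m0 : {measure set (measurableTypeR R) -> \bar R} :=
  mscale (NngNum c0') (pushforward leb phi).
pose m := m0 mphi.
have mE A : measurable A -> leb A = m A.
  apply: lebesgue_measure_unique => _ [[x y]] _ <-.
  rewrite [RHS](_ : _ = c%:E * leb (phi @^-1` `]x, y]))//.
  have -> : phi @^-1` [set` `]x, y]] = [set` `](x - a) / c, (y - a) / c]]%R.
    apply/seteqP; split=> z /=; rewrite !in_itv /= ltr_pdivrMr// ler_pdivlMr//
      ltrBlDr lerBrDr /phi mulrC//.
  rewrite !lebesgue_measure_itv /= !lte_fin ltr_pM2r ?invr_gt0// ltrD2r.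
  case: ifP => _; last by rewrite mule0.
  rewrite -!EFinD -EFinM -mulrBl mulrC divfK ?gt_eqF//; congr (_%:E); ring.
transitivity (\int[m]_x F x).
  apply: eq_measure_integral => A mA _; first [exact: mE | exact/esym/mE].
rewrite ge0_integral_mscale//=; congr (_ * _).
rewrite ge0_integral_pushforward//.
Qed.

End lebesgue_affine.

Section gauss.
Context {R : realType}.
Notation leb := (@lebesgue_measure R).

Lemma integral_gauss (s : R) (F : R -> \bar R) :
  measurable_fun [set: R] F -> (forall x, 0 <= F x) ->
  \int[gauss s]_x F x =
  \int[leb]_x (F x * (normal_pdf 0 s x)%:E).
Proof.
move=> mF F0; rewrite /gauss ge0_integral_distribution//.
apply: ge0_integral_density => //.
- exact: measurable_normal_pdf.
- by move=> x; exact: normal_pdf_ge0.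
Qed.

Lemma normal_peakE (s : R) : (0 < s)%R ->
  normal_peak s = (s^-1 * (Num.sqrt (pi *+ 2))^-1)%R.
Proof.
move=> s0; rewrite /normal_peak -mulrnAr sqrtrM ?sqr_ge0// sqrtr_sqr.
by rewrite ger0_norm ?(ltW s0)// invfM.
Qed.

(* The density of N(x, s^2) with respect to N(0, t^2). *)
Definition gauss_ratio (s t x y : R) : R :=
  (t / s * expR (y ^+ 2 / (t ^+ 2 *+ 2) - (y - x) ^+ 2 / (s ^+ 2 *+ 2)))%R.

Lemma gauss_ratio_ge0 (s t x y : R) : (0 < s)%R -> (0 < t)%R ->
  (0 <= gauss_ratio s t x y)%R.
Proof.
by move=> s0 t0; rewrite /gauss_ratio mulr_ge0 ?expR_ge0// divr_ge0// ltW.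
Qed.

Lemma measurable_gauss_ratio (s t x : R) :
  measurable_fun [set: R] (gauss_ratio s t x).
Proof.
apply: measurable_funM => //; apply: measurableT_comp => //.
apply: measurable_funB; apply: measurable_funM => //; apply: measurable_funX => //.
exact: measurable_funB.
Qed.

Lemma integral_gauss_shift (s t x : R) (F : R -> \bar R) :
  (0 < s)%R -> (0 < t)%R ->
  measurable_fun [set: R] F -> (forall y, 0 <= F y) ->
  \int[gauss s]_w F (x + w)%R =
  \int[gauss t]_y (F y * (gauss_ratio s t x y)%:E).
Proof.
move=> s0 t0 mF F0.
have mFx : measurable_fun [set: R] (fun w => F (x + w)%R).
  by apply: (measurableT_comp mF); exact: measurable_funD.
rewrite (integral_gauss s mFx (fun w => F0 _)).
rewrite integral_gauss; first last.
- by move=> y; rewrite mule_ge0// lee_fin gauss_ratio_ge0.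
- apply: emeasurable_funM => //; apply/measurable_EFinP.
  exact: measurable_gauss_ratio.
rewrite [RHS](@ge0_integral_affine _ 1 x) ?ltr01//; first last.
- move=> y; rewrite !mule_ge0// lee_fin; first exact: gauss_ratio_ge0.
  exact: normal_pdf_ge0.
- apply: emeasurable_funM => //; last first.
    by apply/measurable_EFinP; exact: measurable_normal_pdf.
  apply: emeasurable_funM => //; apply/measurable_EFinP.
  exact: measurable_gauss_ratio.
rewrite mul1e; apply: eq_integral => w _.
rewrite mul1r addrC -muleA; congr (_ * _); rewrite -EFinM; congr (_%:E).
rewrite !normal_pdfE ?gt_eqF// /normal_fun !normal_peakE// /gauss_ratio !subr0.
rewrite (_ : (w + x - x = w)%R); last by rewrite addrK.
rewrite mulrACA -expRD; congr (_ * expR _)%R; last by rewrite !mulNr addrAC subrr add0r.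
by rewrite mulrACA divff ?gt_eqF// mul1r.
Qed.

(** Completing the square: with [D = 1 - 2 a s^2], the integrand times the density is a multiple of
    the density of N(b s^2 / D, s^2 / D), which integrates to one. *)
Lemma integral_gauss_expR (s a b : R) : (0 < s)%R ->
  (0 < 1 - 2 * a * s ^+ 2)%R ->
  \int[gauss s]_y (expR (a * y ^+ 2 + b * y))%:E =
  ((Num.sqrt (1 - 2 * a * s ^+ 2))^-1 *
   expR (b ^+ 2 * s ^+ 2 / (2 * (1 - 2 * a * s ^+ 2))))%:E.
Proof.
move=> s0; set D := (1 - 2 * a * s ^+ 2)%R => D0.
have rD0 : (0 < Num.sqrt D)%R by rewrite sqrtr_gt0.
rewrite integral_gauss//; last first.
- apply/measurable_EFinP/measurableT_comp => //; apply: measurable_funD => //.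
  by apply: measurable_funM => //; exact: measurable_funX.
pose u := (s / Num.sqrt D)%R.
have u0 : (0 < u)%R by rewrite divr_gt0.
pose m := (b * s ^+ 2 / D)%R.
pose k := ((Num.sqrt D)^-1 * expR (b ^+ 2 * s ^+ 2 / (2 * D)))%R.
transitivity (\int[leb]_x (k%:E * (normal_pdf m u x)%:E)).
  apply: eq_integral => y _; rewrite -!EFinM; congr (_%:E).
  rewrite !normal_pdfE ?gt_eqF// /normal_fun !normal_peakE// /k.
  rewrite subr0 mulrCA -expRD [RHS]mulrACA -expRD; congr (_ * expR _)%R.
    by rewrite /u invfM invrK [RHS]mulrCA !mulrA mulfK ?gt_eqF.
  rewrite /u exprMn exprVn sqr_sqrtr ?(ltW D0)// /m.
  rewrite /D; field.
  by rewrite -/D !gt_eqF.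
rewrite ge0_integralZl//; last 3 first.
- by apply/measurable_EFinP; exact: measurable_normal_pdf.
- by move=> y _; rewrite lee_fin normal_pdf_ge0.
- by rewrite lee_fin mulr_ge0 ?invr_ge0 ?expR_ge0// ltW.
by rewrite integral_normal_pdf mule1.
Qed.

End gauss.

Local Close Scope ereal_scope.

(** * Reduction modulo one and the uniform law on the circle *)

Section cfrac.
Context {R : realType}.
Notation leb := (@lebesgue_measure R).

Lemma half_lt : (- 2^-1 < 2^-1 :> R)%R. Proof. lra. Qed.

Definition unif : probability R R :=
  distribution (uniform_prob half_lt : probability (measurableTypeR R) R)
    (@to_real R).

(** The representative of [y] modulo Z in the half-open interval from -1/2 to 1/2. *)
Definition cfrac (y : R) : R := (y - (Num.floor (y + 2^-1))%:~R)%R.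

Lemma cfrac_itv y : (- 2^-1 <= cfrac y < 2^-1)%R.
Proof.
have := floor_itv (y + 2^-1)%R; rewrite /cfrac => /andP[]; rewrite intrD.
by lra.
Qed.

Lemma cfrac_id y : (- 2^-1 <= y < 2^-1)%R -> cfrac y = y.
Proof.
move=> y2; rewrite /cfrac (_ : Num.floor _ = 0) ?subr0//.
by apply: floor_def; rewrite add0r; lra.
Qed.

Lemma cfracDz y (z : int) : cfrac (y + z%:~R) = cfrac y.
Proof.
have fz : Num.floor (z%:~R : R) = z by exact: intrKfloor.
have fy : Num.floor (y + z%:~R + 2^-1) = Num.floor (y + 2^-1) + z.
  by rewrite addrAC floorDrz ?intr_int// fz.
by rewrite /cfrac fy rmorphD/=; ring.
Qed.

Lemma cfracE y : exists z : int, y = (cfrac y + z%:~R)%R.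
Proof. by exists (Num.floor (y + 2^-1)); rewrite /cfrac subrK. Qed.

Lemma cfracD x y : cfrac (cfrac x + y) = cfrac (x + y).
Proof.
by have [z xz] := cfracE x; rewrite [in RHS]xz (addrAC (cfrac x)) cfracDz.
Qed.

(** The centred representative has least absolute value in its class, since a nonzero integer shift
    of a number of size at most 1/2 cannot shorten it. Hence wrapping around the torus never works
    against the decoder. *)
Lemma cfrac_sqr_le y : (cfrac y ^+ 2 <= y ^+ 2)%R.
Proof.
have [z yz] := cfracE y; have /andP[w1 w2] := cfrac_itv y.
have [z0|z1|z1] := ltgtP z 0; last by rewrite {2}yz z1 addr0.
- have : (z%:~R <= -1 :> R)%R by rewrite (_ : -1 = (-1)%:~R)// ler_int; lia.
  by rewrite {2}yz; nra.
- have : (1 <= z%:~R :> R)%R by rewrite ler1z; lia.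
  by rewrite {2}yz; nra.
Qed.

Lemma measurable_cfrac : measurable_fun [set: R] cfrac.
Proof.
apply: measurable_funB => //; apply: nondecreasing_measurable => // x y xy.
by rewrite ler_int le_floor// lerD2r.
Qed.

Let ind (x : R) : R := (if (- 2^-1 <= x < 2^-1) then 1 else 0)%R.

Lemma measurable_ind : measurable_fun [set: R] ind.
Proof.
apply: measurable_fun_ifT => //; apply: measurable_and => //.
- exact: measurable_fun_ler.
- exact: measurable_fun_ltr.
Qed.

Lemma integral_unif (F : R -> \bar R) :
  measurable_fun [set: R] F -> (forall x, 0 <= F x)%E ->
  (\int[unif]_x F x = \int[leb]_x (F x * (ind x)%:E))%E.
Proof.
move=> mF F0; rewrite /unif ge0_integral_distribution// integral_uniform//.
rewrite (_ : (2^-1 - - 2^-1)^-1 = 1)%R; last by field.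
(* The uniform law is given on the closed interval; its right end is a null set. *)
rewrite mul1e -integral_itv_bndo_bndc; last first.
  exact: measurable_funTS.
rewrite integral_mkcond; apply: eq_integral => x _; rewrite patchE /ind.
by rewrite mem_setE in_itv /=; case: ifP => _; rewrite ?mule1 ?mule0.
Qed.

(** Translation invariance on the circle. After reducing the shift to [0 <= b < 1], the period is
    cut at [1/2 - b]; its pieces, moved by [b] and by [b - 1], become the sets indicated by [i1] and
    [i2], which together fill the period again. *)
Lemma integral_unif_cfrac (a : R) (F : R -> \bar R) :
  measurable_fun [set: R] F -> (forall x, 0 <= F x)%E ->
  (\int[unif]_x F (cfrac (x + a)) = \int[unif]_x F x)%E.
Proof.
move=> mF F0.
pose b := (a - (Num.floor a)%:~R)%R.
have b01 : (0 <= b < 1)%R.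
  by have := floor_itv a; rewrite /b => /andP[]; rewrite intrD; lra.
have wab x : cfrac (x + a) = cfrac (x + b).
  by rewrite /b addrA -rmorphN cfracDz.
have wab1 (x : R) : F (cfrac (x + (b - 1))) = F (cfrac (x + b)).
  by rewrite -(cfracDz (x + b) (-1)) mulrN1z addrA.
under eq_integral do rewrite wab.
rewrite !integral_unif//; last first.
  apply: measurableT_comp => //; apply: measurableT_comp measurable_cfrac _.
  exact: measurable_funD.
pose i1 (x : R) : R := (if (b - 2^-1 <= x < 2^-1) then 1 else 0)%R.
pose i2 (x : R) : R := (if (- 2^-1 <= x < b - 2^-1) then 1 else 0)%R.
have mi1 : measurable_fun [set: R] i1.
  apply: measurable_fun_ifT => //; apply: measurable_and => //.
  - exact: measurable_fun_ler.
  - exact: measurable_fun_ltr.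
have mi2 : measurable_fun [set: R] i2.
  apply: measurable_fun_ifT => //; apply: measurable_and => //.
  - exact: measurable_fun_ler.
  - exact: measurable_fun_ltr.
have m1 : measurable_fun [set: R] (fun x => F x * (i1 x)%:E)%E.
  by apply: emeasurable_funM => //; exact/measurable_EFinP.
have m2 : measurable_fun [set: R] (fun x => F x * (i2 x)%:E)%E.
  by apply: emeasurable_funM => //; exact/measurable_EFinP.
have p1 x : (0 <= F x * (i1 x)%:E)%E by rewrite mule_ge0// lee_fin /i1; case: ifP.
have p2 x : (0 <= F x * (i2 x)%:E)%E by rewrite mule_ge0// lee_fin /i2; case: ifP.
have ms e (G : R -> \bar R) : measurable_fun [set: R] G ->
    measurable_fun [set: R] (fun x => G (1 * x + e)).
  move=> mG; apply: measurableT_comp => //; apply: measurable_funD => //.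
transitivity (\int[leb]_x (F x * (i1 x)%:E) + \int[leb]_x (F x * (i2 x)%:E))%E.
  rewrite (ge0_integral_affine b (@ltr01 R) m1 p1) mul1e.
  rewrite (ge0_integral_affine (b - 1) (@ltr01 R) m2 p2) mul1e.
  rewrite -ge0_integralD//; [|exact: (ms b _ m1)|exact: (ms (b - 1) _ m2)].
  apply: eq_integral => x _; rewrite !mul1r /i1 /i2 /ind.
  have [x1|x1] := boolP (- 2^-1 <= x < 2^-1); last first.
    have /negbTE -> : ~~ (b - 2^-1 <= x + b < 2^-1) by lra.
    have /negbTE -> : ~~ (- 2^-1 <= x + (b - 1) < b - 2^-1) by lra.
    by rewrite !mule0 add0e.
  rewrite mule1; have [x2|x2] := ltP (x + b) 2^-1.
    have -> : b - 2^-1 <= x + b by lra.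
    have /negbTE -> : ~~ (- 2^-1 <= x + (b - 1) < b - 2^-1) by lra.
    by rewrite mule0 adde0 mule1 cfrac_id//; lra.
  rewrite andbF mule0 add0e.
  have -> : (- 2^-1 <= x + (b - 1) < b - 2^-1) by lra.
  rewrite mule1 -(cfrac_id (y := x + (b - 1))); last by lra.
  by rewrite [RHS]wab1.
rewrite -ge0_integralD//; apply: eq_integral => x _; rewrite /i1 /i2 /ind.
have [x1|x1] := boolP (- 2^-1 <= x < 2^-1); last first.
  have /negbTE -> : ~~ (b - 2^-1 <= x < 2^-1) by lra.
  have /negbTE -> : ~~ (- 2^-1 <= x < b - 2^-1) by lra.
  by rewrite !mule0 add0e.
have [x2|x2] := ltP x (b - 2^-1).
  have -> : - 2^-1 <= x by lra.
  by rewrite mule0 add0e.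
have -> : x < 2^-1 by lra.
by rewrite andbF mule0 adde0.
Qed.

(** The bound [c <= 1] keeps the image inside one period, so that it has a density with respect to
    [unif]. *)
Lemma integral_unif_scale (c : R) (F : R -> \bar R) : 0 < c <= 1 ->
  measurable_fun [set: R] F -> (forall x, 0 <= F x)%E ->
  (\int[unif]_x F (c * x)%R =
   \int[unif]_x (F x * (c^-1 * (- (c / 2) <= x < c / 2)%R%:R)%R%:E))%E.
Proof.
move=> /andP[c0 c1] mF F0.
pose i (x : R) : R := (if (- (c / 2) <= x < c / 2) then 1 else 0)%R.
have mi : measurable_fun [set: R] i.
  apply: measurable_fun_ifT => //; apply: measurable_and => //.
  - exact: measurable_fun_ler.
  - exact: measurable_fun_ltr.
have iE x : (- (c / 2) <= x < c / 2)%R%:R = i x.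
  by rewrite /i; case: ifP.
under [RHS]eq_integral do rewrite iE.
have mcF : measurable_fun [set: R] (fun x => F x * (c^-1 * i x)%:E)%E.
  apply: emeasurable_funM => //; apply/measurable_EFinP.
  exact: measurable_funM.
have p x : (0 <= F x * (c^-1 * i x)%:E)%E.
  by rewrite mule_ge0// lee_fin mulr_ge0 ?invr_ge0 ?(ltW c0)// /i; case: ifP.
rewrite !integral_unif//; last first.
  by apply: measurableT_comp => //; exact: measurable_funM.
have mcFi : measurable_fun [set: R]
    (fun x => F x * (c^-1 * i x)%:E * (ind x)%:E)%E.
  by apply: emeasurable_funM => //; apply/measurable_EFinP; exact: measurable_ind.
have pi x : (0 <= F x * (c^-1 * i x)%:E * (ind x)%:E)%E.
  by rewrite mule_ge0// lee_fin /ind; case: ifP.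
rewrite (ge0_integral_affine 0 c0 mcFi pi) -ge0_integralZl//; last 2 first.
- apply: (measurableT_comp mcFi).
  by apply: measurable_funD => //; exact: measurable_funM.
- by rewrite lee_fin ltW.
apply: eq_integral => x _; rewrite addr0 /i /ind.
have -> : (- (c / 2) <= c * x < c / 2) = (- 2^-1 <= x < 2^-1).
  by rewrite -mulrN !ler_pM2l// ltr_pM2l.
case: ifP => [x1|_]; last by rewrite !(mulr0, mule0) mul0e mule0.
have -> : - 2^-1 <= c * x < 2^-1 by apply/andP; split; nra.
rewrite mulr1 !mule1 muleCA -EFinM divff ?mule1// gt_eqF//.
Qed.

End cfrac.

(** * Gaussian vectors *)

Lemma measurable_setb d (T : measurableType d) (b : T -> bool) :
  measurable_fun [set: T] b -> measurable [set x | b x].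
Proof.
move=> mb; rewrite -[X in measurable X]setTI.
rewrite (_ : [set x | b x] = b @^-1` [set true]); first exact: mb.
by apply/seteqP; split => x /=; [move->|].
Qed.

Section vectors.
Context {R : realType}.

Lemma vaddC n : commutative (@vadd R n).
Proof. by move=> x y; apply: eq_from_tnth => i; rewrite !tnth_mktuple addrC. Qed.

Lemma vaddA n : associative (@vadd R n).
Proof. by move=> x y z; apply: eq_from_tnth => i; rewrite !tnth_mktuple addrA. Qed.

Lemma measurable_vadd d (T : measurableType d) n (f g : T -> n.-tuple R) :
  measurable_fun [set: T] f -> measurable_fun [set: T] g ->
  measurable_fun [set: T] (fun x => vadd (f x) (g x)).
Proof.
move=> mf mg; apply: (measurable_tuple (f := fun i x => tnth (f x) i + tnth (g x) i)) => i.
have mt := @measurable_tnth _ R n i.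
by apply: measurable_funD; [exact: (measurableT_comp mt mf)|exact: (measurableT_comp mt mg)].
Qed.

Lemma measurable_fun_bigsum d (T : measurableType d) (I : Type)
    (r : seq I) (f : I -> T -> R) :
  (forall i, measurable_fun [set: T] (f i)) ->
  measurable_fun [set: T] (fun x => \sum_(i <- r) f i x)%R.
Proof.
move=> mf; elim: r => [|i r IHr].
  by under eq_fun do rewrite big_nil; exact: measurable_cst.
by under eq_fun do rewrite big_cons; exact: measurable_funD.
Qed.

Lemma measurable_sqnorm n : measurable_fun [set: n.-tuple R] (@sqnorm R n).
Proof.
apply: measurable_fun_bigsum => i; apply: measurable_funX.
exact: measurable_tnth.
Qed.

Lemma sqnorm_vadd_sum n (x y : n.-tuple R) (a b : R) :
  a * (sqnorm (vadd x y) - n%:R * b) =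
  \sum_(i < n) (a * (tnth x i + tnth y i) ^+ 2 - a * b).
Proof.
rewrite sumrB -mulr_sumr mulrBr; congr (_ * _ - _).
  by apply: eq_bigr => i _; rewrite tnth_mktuple.
by rewrite sumr_const card_ord -[RHS]mulr_natl mulrCA.
Qed.

End vectors.

(** * Large deviations of the norm of a shifted Gaussian vector *)

Section gauss_tail.
Context {R : realType}.
Implicit Types s A N x : R.

(** From [1 + x <= expR x] at [x = D^-1 - 1]. It puts normalising factors into exponential form, so
    that bounds per coordinate turn into sums of exponents. *)
Lemma invsqrt_le_expR (D : R) : 0 < D ->
  (Num.sqrt D)^-1 <= expR ((D^-1 - 1) / 2).
Proof.
move=> D0; rewrite -sqrtrV ?(ltW D0)// -[leRHS]ger0_norm ?expR_ge0//.
rewrite -[leLHS]ger0_norm ?sqrtr_ge0// -ler_sqr ?nnegrE ?normr_ge0//.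
rewrite !real_normK ?num_real// sqr_sqrtr ?invr_ge0 ?(ltW D0)// -expRM_natl.
have := expR_ge1Dx (D^-1 - 1); rewrite addrC subrK => /le_trans; apply.
by rewrite ler_expR; lra.
Qed.

(** Chernoff bound: the exponential moment of the squared norm of [j + z] depends on [j] only
    through its norm, so one [rho] serves all lengths and all jamming vectors. The converse uses it
    with [A = 0], the coding scheme with [A = L]. *)
Lemma gauss_tail s A N : 0 < s -> 0 <= A -> A + s ^+ 2 < N ->
  exists2 rho, 0 < rho < 1 & forall n (j : n.-tuple R), sqnorm j <= n%:R * A ->
  (gauss_vec n s [set z | (n%:R * N < sqnorm (vadd j z))%R] <= (rho ^+ n)%:E)%E.
Proof.
move=> s0 A0 AN.
have s20 : 0 < s ^+ 2 by rewrite exprn_gt0.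
have N0 : 0 < N by lra.
pose q := (A + s ^+ 2) / N.
have q0 : 0 < q by rewrite divr_gt0//; lra.
have q1 : q < 1 by rewrite ltr_pdivrMr// mul1r.
(* Any [D] strictly between [q] and 1 works: [D < 1] makes [lam] positive, and [q < D] makes the
   final exponent negative. *)
pose D := (1 + q) / 2.
have D0 : 0 < D by rewrite /D; lra.
have D1 : D < 1 by rewrite /D; lra.
pose lam := (1 - D) / (2 * s ^+ 2).
have lam0 : 0 < lam by rewrite divr_gt0//; lra.
have lamD : 1 - 2 * lam * s ^+ 2 = D.
  by rewrite /lam; field; rewrite gt_eqF.
have rho0 : lam * ((A + s ^+ 2) / D - N) < 0.
  rewrite pmulr_rlt0// subr_lt0 ltr_pdivrMr// -ltr_pdivrMl// mulrC -/q /D; lra.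
exists (expR (lam * ((A + s ^+ 2) / D - N))).
  by rewrite expR_gt0/= expR_lt1.
move=> n j jA.
pose f (z : n.-tuple R) := expR (lam * (sqnorm (vadd j z) - n%:R * N)).
have mv : measurable_fun [set: n.-tuple R] (fun z => sqnorm (vadd j z)).
  by apply: (measurableT_comp (@measurable_sqnorm R n)); exact: measurable_vadd.
have mf : measurable_fun [set: n.-tuple R] f.
  apply: measurableT_comp => //; apply: measurable_funM => //.
  exact: measurable_funB.
set E := [set z | _].
have mE : measurable E.
  by apply: measurable_setb; exact: measurable_fun_ltr.
rewrite -(setIT E) -integral_indic//.
apply: (@le_trans _ _ (\int[gauss_vec n s]_z (f z)%:E)%E).
  apply: ge0_le_integral => //.
  - by apply/measurable_EFinP; exact: measurable_indic.
  - exact/measurable_EFinP.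
  - move=> z _; rewrite lee_fin indicE; case: (boolP (z \in E)) => [|_]; last exact: expR_ge0.
    rewrite inE /E /= => zE; rewrite -expR0 ler_expR mulr_ge0 ?(ltW lam0)//.
    by rewrite subr_ge0 ltW.
pose h i (z : R) := expR (lam * (tnth j i + z) ^+ 2 - lam * N).
pose c i := expR (lam * tnth j i ^+ 2 - lam * N) *
  ((Num.sqrt D)^-1 * expR ((2 * lam * tnth j i) ^+ 2 * s ^+ 2 / (2 * D))).
have mh i : measurable_fun [set: R] (h i).
  apply: measurableT_comp => //; apply: measurable_funB => //.
  by apply: measurable_funM => //; apply: measurable_funX; exact: measurable_funD.
have fE z : f z = \prod_(i < n) h i (tnth z i).
  by rewrite /f sqnorm_vadd_sum expR_sum.
under eq_integral do rewrite fE.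
rewrite (integral_iid_prod (c := c))//; first last.
- move=> i.
  transitivity (\int[gauss s]_z ((expR (lam * tnth j i ^+ 2 - lam * N))%:E *
      (expR (lam * z ^+ 2 + 2 * lam * tnth j i * z))%:E))%E.
    apply: eq_integral => z _; rewrite -EFinM -expRD /h; congr (expR _)%:E; ring.
  rewrite ge0_integralZl//; first last.
  - apply/measurable_EFinP/measurableT_comp => //; apply: measurable_funD => //.
    by apply: measurable_funM => //; exact: measurable_funX.
  by rewrite integral_gauss_expR// lamD.
- by move=> i z; exact: expR_ge0.
rewrite lee_fin.
(* By [1 - 2 * lam * s ^+ 2 = D], the two coefficients of [tnth j i ^+ 2] add up to [lam / D], and
   [(D^-1 - 1) / 2] equals [lam * s ^+ 2 / D]. *)
apply: (@le_trans _ _ (\prod_(i < n)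
  expR (lam * tnth j i ^+ 2 / D + (lam * s ^+ 2 / D - lam * N)))).
  apply: ler_prod => i _; rewrite /c !mulr_ge0 ?expR_ge0 ?invr_ge0 ?sqrtr_ge0//=.
  apply: (@le_trans _ _ (expR (lam * tnth j i ^+ 2 - lam * N) *
    (expR ((D^-1 - 1) / 2) *
     expR ((2 * lam * tnth j i) ^+ 2 * s ^+ 2 / (2 * D))))).
    by rewrite ler_pM2l ?expR_gt0// ler_pM2r ?expR_gt0// invsqrt_le_expR.
  rewrite -!expRD ler_expR le_eqVlt; apply/orP; left; apply/eqP.
  by rewrite -lamD; field; rewrite lamD gt_eqF.
rewrite -expR_sum -expRM_natl ler_expR big_split /= sumr_const card_ord.
rewrite -mulr_suml -mulr_sumr -/(sqnorm j) -[X in _ + X <= _]mulr_natl.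
have : lam * sqnorm j / D <= lam * (n%:R * A) / D.
  by rewrite ler_pM2r ?invr_gt0// ler_pM2l.
set a := lam * sqnorm j / D => aA.
have -> : n%:R * (lam * ((A + s ^+ 2) / D - N)) =
  lam * (n%:R * A) / D + n%:R * (lam * s ^+ 2 / D - lam * N) by ring.
by rewrite lerD2r.
Qed.

End gauss_tail.

(** * Likelihood ratios of Gaussian laws and their moments *)

Section gauss_density.
Context {R : realType}.
Implicit Types s t v : R.

Definition gauss_vec_ratio n s t (x y : n.-tuple R) : R :=
  \prod_(i < n) gauss_ratio s t (tnth x i) (tnth y i).

Lemma integral_gauss_vec_shift n s t (x : n.-tuple R)
    (F : n.-tuple R -> \bar R) : 0 < s -> 0 < t ->
  measurable_fun [set: n.-tuple R] F -> (forall y, 0 <= F y)%E ->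
  (\int[gauss_vec n s]_z F (vadd x z) =
   \int[gauss_vec n t]_y (F y * (gauss_vec_ratio s t x y)%:E))%E.
Proof.
move=> s0 t0 mF F0; rewrite /gauss_vec.
apply: (@integral_iid_transfer _ _ _ _ _ (gauss s) (gauss t) n
  (fun i w => tnth x i + w) (fun i y => gauss_ratio s t (tnth x i) y)
  _ _ _ _ F mF F0).
- by move=> i; exact: measurable_funD.
- by move=> i; exact: measurable_gauss_ratio.
- by move=> i y; exact: gauss_ratio_ge0.
- by move=> i G mG G0; exact: integral_gauss_shift.
Qed.

(** Convolution of Gaussians at the level of densities: jamming of variance [u ^+ 2] and noise of
    variance [s ^+ 2] merge into one noise of variance [v ^+ 2]. *)
Lemma integral_gauss_ratio_conv s t u v (x y : R) : 0 < s -> 0 < t -> 0 < u ->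
  0 < v -> v ^+ 2 = u ^+ 2 + s ^+ 2 ->
  (\int[gauss u]_g (gauss_ratio s t (x + g) y)%:E = (gauss_ratio v t x y)%:E)%E.
Proof.
move=> s0 t0 u0 v0 vE.
pose a := - (s ^+ 2 *+ 2)^-1.
pose b := (y - x) / s ^+ 2.
have DE : 1 - 2 * a * u ^+ 2 = (v / s) ^+ 2.
  by rewrite /a exprMn vE; field; rewrite gt_eqF.
transitivity (\int[gauss u]_g
   ((t / s * expR (y ^+ 2 / (t ^+ 2 *+ 2) - (y - x) ^+ 2 / (s ^+ 2 *+ 2)))%:E *
     (expR (a * g ^+ 2 + b * g))%:E))%E.
  apply: eq_integral => g _; rewrite -EFinM /gauss_ratio -[in RHS](mulrA (t / s)) -expRD.
  congr (_ * expR _)%:E; rewrite /a /b; field; rewrite !gt_eqF//.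
rewrite ge0_integralZl//; last 2 first.
- apply/measurable_EFinP/measurableT_comp => //; apply: measurable_funD => //.
  by apply: measurable_funM => //; exact: measurable_funX.
- by rewrite lee_fin !mulr_ge0 ?expR_ge0 ?invr_ge0 ?(ltW t0) ?(ltW s0).
rewrite integral_gauss_expR// DE; last by rewrite exprn_gt0// divr_gt0.
rewrite sqrtr_sqr ger0_norm; last by rewrite divr_ge0 ?(ltW s0) ?(ltW v0).
rewrite -EFinM mulrACA -expRD /gauss_ratio; congr (_ * expR _)%:E.
  by field; rewrite !gt_eqF.
rewrite /b [(v / s) ^+ 2]exprMn exprVn vE; field.
by rewrite -vE !gt_eqF ?exprn_gt0.
Qed.

Lemma gauss_vec_ratio_ge0 n s t (x y : n.-tuple R) : 0 < s -> 0 < t -> 0 <= gauss_vec_ratio s t x y.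
Proof. by move=> s0 t0; apply: prodr_ge0 => i _; exact: gauss_ratio_ge0. Qed.

Lemma measurable_gauss_vec_ratio d (T : measurableType d) n s t (f g : T -> n.-tuple R) :
  measurable_fun [set: T] f -> measurable_fun [set: T] g ->
  measurable_fun [set: T] (fun w => gauss_vec_ratio s t (f w) (g w)).
Proof.
move=> mf mg; apply: measurable_fun_bigprod => i; rewrite /gauss_ratio.
have mi := @measurable_tnth _ R n i.
have m1 : measurable_fun [set: T] (fun w => tnth (f w) i).
  exact: (measurableT_comp mi mf).
have m2 : measurable_fun [set: T] (fun w => tnth (g w) i).
  exact: (measurableT_comp mi mg).
apply: measurable_funM => //; apply: measurableT_comp => //.
apply: measurable_funB; apply: measurable_funM => //; apply: measurable_funX => //.
exact: measurable_funB.
Qed.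

Lemma integral_gauss_vec_conv n s t u v (x : n.-tuple R)
    (F : n.-tuple R -> \bar R) : 0 < s -> 0 < t -> 0 < u ->
  0 < v -> v ^+ 2 = u ^+ 2 + s ^+ 2 ->
  measurable_fun [set: n.-tuple R] F -> (forall y, 0 <= F y)%E ->
  (\int[gauss_vec n u]_g \int[gauss_vec n s]_z F (vadd (vadd x g) z) =
   \int[gauss_vec n t]_y (F y * (gauss_vec_ratio v t x y)%:E))%E.
Proof.
move=> s0 t0 u0 v0 vE mF F0.
transitivity (\int[gauss_vec n u]_g \int[gauss_vec n t]_y
    (F y * (gauss_vec_ratio s t (vadd x g) y)%:E))%E.
  by apply: eq_integral => g _; exact: integral_gauss_vec_shift.
rewrite (fubini_tonelli (fun gy : n.-tuple R * n.-tuple R =>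
  F gy.2 * (gauss_vec_ratio s t (vadd x gy.1) gy.2)%:E))%E; last 2 first.
- apply: emeasurable_funM; first exact: (measurableT_comp mF).
  by apply/measurable_EFinP; apply: measurable_gauss_vec_ratio => //; exact: measurable_vadd.
- by move=> gy; rewrite mule_ge0// lee_fin gauss_vec_ratio_ge0.
apply: eq_integral => y _ /=; rewrite ge0_integralZl//; first last.
- by move=> g _; rewrite lee_fin gauss_vec_ratio_ge0.
- by apply/measurable_EFinP; apply: measurable_gauss_vec_ratio => //; exact: measurable_vadd.
congr (_ * _)%E.
rewrite /gauss_vec_ratio; under eq_integral do under eq_bigr do rewrite tnth_mktuple.
rewrite (integral_iid_prod (h := fun i g => gauss_ratio s t (tnth x i + g) (tnth y i))
  (c := fun i => gauss_ratio v t (tnth x i) (tnth y i)))//.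
- move=> i; rewrite /gauss_ratio.
  apply: measurable_funM => //; apply: measurableT_comp => //.
  apply: measurable_funB => //; apply: measurable_funM => //.
  apply: measurable_funX; apply: measurable_funB => //.
  exact: measurable_funD.
- by move=> i g; exact: gauss_ratio_ge0.
- by move=> i; exact: integral_gauss_ratio_conv.
Qed.


(** The integrand is [gauss_ratio s t x y] to the power [1 + lam]: this is the moment behind the
    Renyi divergence of order [1 + lam]. It is finite for every [lam >= 0] because [t >= s]. *)
Lemma integral_gauss_ratio_pow s t P lam x : 0 < s -> 0 < t -> 0 <= P ->
  0 <= lam -> t ^+ 2 = P + s ^+ 2 ->
  (\int[gauss t]_y (expR ((1 + lam) * (ln (t / s) + y ^+ 2 / (t ^+ 2 *+ 2)
       - (y - x) ^+ 2 / (s ^+ 2 *+ 2))))%:E =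
   (expR (lam * ln (t / s)) * ((Num.sqrt (1 + lam * P / t ^+ 2))^-1 *
      expR (lam * (1 + lam) * x ^+ 2 / (2 * (t ^+ 2 + lam * P)))))%:E)%E.
Proof.
move=> s0 t0 P0 lam0 tE.
have lamP : 0 <= lam * P by exact: mulr_ge0.
have t20 : 0 < t ^+ 2 by exact: exprn_gt0.
have s20 : 0 < s ^+ 2 by exact: exprn_gt0.
have tP : 0 < t ^+ 2 + lam * P by lra.
have uP : 0 < 1 + lam * P / t ^+ 2 by rewrite ltr_pwDl// divr_ge0// ltW.
have ts0 : 0 < t / s by exact: divr_gt0.
pose a := (1 + lam) * ((t ^+ 2 *+ 2)^-1 - (s ^+ 2 *+ 2)^-1).
pose b := (1 + lam) * x / s ^+ 2.
have DE : 1 - 2 * a * t ^+ 2 = (t / s) ^+ 2 * (1 + lam * P / t ^+ 2).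
  rewrite /a [(t / s) ^+ 2]exprMn exprVn tE; field.
  by rewrite -tE !gt_eqF.
transitivity (\int[gauss t]_y
   ((expR ((1 + lam) * (ln (t / s) - x ^+ 2 / (s ^+ 2 *+ 2))))%:E *
     (expR (a * y ^+ 2 + b * y))%:E))%E.
  apply: eq_integral => y _; rewrite -EFinM -expRD.
  by congr (expR _)%:E; rewrite /a /b; field; rewrite !gt_eqF.
rewrite ge0_integralZl//; last first.
  apply/measurable_EFinP/measurableT_comp => //; apply: measurable_funD => //.
  by apply: measurable_funM => //; exact: measurable_funX.
rewrite integral_gauss_expR// DE; last by rewrite mulr_gt0// exprn_gt0.
rewrite sqrtrM ?sqr_ge0// sqrtr_sqr ger0_norm ?(ltW ts0)// invfM.
rewrite -EFinM; congr (_%:E).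
have -> : (t / s)^-1 = expR (- ln (t / s)) by rewrite expRN lnK ?posrE.
have assoc (A T r E L M : R) : A * (T * E) = L * M ->
    A * (T * r * E) = L * (r * M).
  by move=> H; transitivity (r * (A * (T * E))); [|rewrite H]; ring.
apply: assoc.
rewrite -!expRD; congr expR.
rewrite /b [(t / s) ^+ 2]exprMn exprVn.
rewrite tE; field.
by rewrite -tE !gt_eqF.
Qed.

Lemma gauss_ratio_expR s t x y : 0 < s -> 0 < t ->
  gauss_ratio s t x y = expR (ln (t / s) + y ^+ 2 / (t ^+ 2 *+ 2)
       - (y - x) ^+ 2 / (s ^+ 2 *+ 2)).
Proof.
by move=> s0 t0; rewrite -addrA expRD lnK// posrE divr_gt0.
Qed.

Lemma gauss_vec_ratio_expR n s t (x y : n.-tuple R) : 0 < s -> 0 < t ->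
  gauss_vec_ratio s t x y = expR (\sum_(i < n) (ln (t / s) +
    tnth y i ^+ 2 / (t ^+ 2 *+ 2) -
    (tnth y i - tnth x i) ^+ 2 / (s ^+ 2 *+ 2))).
Proof.
move=> s0 t0; rewrite expR_sum; apply: eq_bigr => i _.
exact: gauss_ratio_expR.
Qed.

(* The hypothesis-testing bound: with T = e^(n g) and r the likelihood ratio,
   r <= T + r^(1 + lam) T^(-lam), and the choice lam = kappa balances the
   Renyi divergence of order 1 + lam. *)
Lemma gauss_success_bound n s t P kappa (x : n.-tuple R) (D : set (n.-tuple R)) :
  0 < s -> 0 < t -> 0 < P -> 0 < kappa -> t ^+ 2 = P + s ^+ 2 ->
  sqnorm x <= n%:R * P -> measurable D ->
  (\int[gauss_vec n t]_y ((\1_D y)%:E * (gauss_vec_ratio s t x y)%:E) <=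
   (expR (n%:R * (ln (t / s) + kappa)))%:E * gauss_vec n t D +
   (expR (- (n%:R * (kappa ^+ 2 / 2))))%:E)%E.
Proof.
move=> s0 t0 P0 k0 tE xP mD.
have t20 : 0 < t ^+ 2 by exact: exprn_gt0.
have tP : 0 < t ^+ 2 + kappa * P by rewrite ltr_wpDr// mulr_ge0 ?ltW.
set g := ln (t / s) + kappa.
pose l (i : 'I_n) (y : R) := ln (t / s) + y ^+ 2 / (t ^+ 2 *+ 2) -
  (y - tnth x i) ^+ 2 / (s ^+ 2 *+ 2).
have ml i : measurable_fun [set: R] (l i).
  apply: measurable_funB; first apply: measurable_funD => //.
    by apply: measurable_funM => //; exact: measurable_funX.
  apply: measurable_funM => //; apply: measurable_funX.
  exact: measurable_funB.
pose h i y := expR ((1 + kappa) * l i y - kappa * g).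
have mh i : measurable_fun [set: R] (h i).
  apply: measurableT_comp => //; apply: measurable_funB => //.
  exact: measurable_funM.
have mhp : measurable_fun [set: n.-tuple R]
    (fun y => \prod_(i < n) h i (tnth y i)).
  apply: measurable_fun_bigprod => i.
  exact: (measurableT_comp (mh i) (@measurable_tnth _ R n i)).
have mDi : measurable_fun [set: n.-tuple R] (fun y => (\1_D y : R)%:E).
  by apply/measurable_EFinP; exact: measurable_indic.
apply: (@le_trans _ _ (\int[gauss_vec n t]_y
  ((expR (n%:R * g))%:E * (\1_D y)%:E + (\prod_(i < n) h i (tnth y i))%:E))%E).
  apply: ge0_le_integral => //.
  - by move=> y _; rewrite mule_ge0// lee_fin gauss_vec_ratio_ge0.
  - apply: emeasurable_funM => //; apply/measurable_EFinP.
    exact: measurable_gauss_vec_ratio.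
  - apply: emeasurable_funD; last exact/measurable_EFinP.
    exact: measurable_funeM.
  - move=> y _; rewrite -!EFinM -EFinD lee_fin indicE.
    have hp : 0 <= \prod_(i < n) h i (tnth y i).
      by apply: prodr_ge0 => i _; exact: expR_ge0.
    case: (y \in D); last by rewrite mul0r mulr0 add0r.
    rewrite mul1r mulr1 gauss_vec_ratio_expR// -/l.
    set S := \sum_(i < n) _.
    have hE : \prod_(i < n) h i (tnth y i) =
        expR ((1 + kappa) * S - kappa * (n%:R * g)).
      rewrite -expR_sum sumrB -mulr_sumr sumr_const card_ord.
      by rewrite -[X in _ - X]mulr_natl mulrCA.
    have [Sg|Sg] := leP S (n%:R * g).
      by rewrite (le_trans (y := expR (n%:R * g))) ?ler_expR// lerDl.
    rewrite hE (le_trans (y := expR ((1 + kappa) * S - kappa * (n%:R * g))))//.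
      by rewrite ler_expR; nra.
    by rewrite lerDr expR_ge0.
rewrite ge0_integralD//; last 3 first.
- exact: measurable_funeM.
- by move=> y _; rewrite lee_fin prodr_ge0// => i _; exact: expR_ge0.
- exact/measurable_EFinP.
rewrite ge0_integralZl//.
rewrite integral_indic// setIT leeD2l//.
pose c i := expR (- (kappa * g)) * (expR (kappa * ln (t / s)) * ((Num.sqrt (1 + kappa * P / t ^+ 2))^-1 *
      expR (kappa * (1 + kappa) * tnth x i ^+ 2 / (2 * (t ^+ 2 + kappa * P))))).
rewrite (integral_iid_prod (c := c))//; last 2 first.
- by move=> i y; exact: expR_ge0.
- move=> i; transitivity (\int[gauss t]_y ((expR (- (kappa * g)))%:E *
      (expR ((1 + kappa) * l i y))%:E))%E.
    by apply: eq_integral => y _; rewrite -EFinM -expRD addrC.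
  rewrite ge0_integralZl//; last first.
    by apply/measurable_EFinP/measurableT_comp => //; exact: measurable_funM.
  by rewrite /l (integral_gauss_ratio_pow (P := P))// ltW.
rewrite lee_fin.
(* By the choice of [g], [- (kappa * g) + kappa * ln (t / s)] is [- kappa ^+ 2]; the other constant
   comes from the square root. *)
apply: (@le_trans _ _ (\prod_(i < n)
   expR (kappa * (1 + kappa) / (2 * (t ^+ 2 + kappa * P)) * tnth x i ^+ 2 +
     (- kappa ^+ 2 - kappa * P / (2 * (t ^+ 2 + kappa * P)))))).
  apply: ler_prod => i _; rewrite /c !mulr_ge0 ?expR_ge0 ?invr_ge0 ?sqrtr_ge0//=.
  have u0 : 0 < 1 + kappa * P / t ^+ 2.
    by rewrite ltr_pwDl// divr_ge0 ?mulr_ge0// ltW.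
  apply: (@le_trans _ _ (expR (- (kappa * g)) * (expR (kappa * ln (t / s)) *
      (expR (((1 + kappa * P / t ^+ 2)^-1 - 1) / 2) *
       expR (kappa * (1 + kappa) * tnth x i ^+ 2 /
         (2 * (t ^+ 2 + kappa * P))))))).
    rewrite !(ler_pM2l (expR_gt0 _)) (ler_pM2r (expR_gt0 _)).
    exact: invsqrt_le_expR.
  rewrite -!expRD ler_expR le_eqVlt; apply/orP; left; apply/eqP.
  rewrite /g; field; rewrite !gt_eqF//=.
rewrite -expR_sum ler_expR big_split /= -mulr_sumr -/(sqnorm x).
rewrite sumr_const card_ord -[X in _ + X <= _]mulr_natl.
have : kappa * (1 + kappa) / (2 * (t ^+ 2 + kappa * P)) * sqnorm x <=
    kappa * (1 + kappa) / (2 * (t ^+ 2 + kappa * P)) * (n%:R * P).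
  apply: ler_wpM2l => //; rewrite divr_ge0 ?mulr_ge0 ?ltW//.
  by rewrite addr_gt0.
set A := (X in X <= _ -> _); move=> AB.
rewrite -lerBrDr (le_trans AB)//.
(* The first summand cancels the contribution of the square root; the second is at most
   [kappa ^+ 2 / 2] and so leaves half of the gain [kappa ^+ 2]. *)
have -> : kappa * (1 + kappa) / (2 * (t ^+ 2 + kappa * P)) * (n%:R * P) =
  n%:R * (kappa * P / (2 * (t ^+ 2 + kappa * P)) +
          kappa ^+ 2 / 2 * (P / (t ^+ 2 + kappa * P))).
  by field; rewrite gt_eqF.
have Pt : P / (t ^+ 2 + kappa * P) <= 1.
  rewrite ler_pdivrMr// mul1r tE -addrA lerDl addr_ge0 ?sqr_ge0//.
  by rewrite mulr_ge0 ?ltW.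
have n0 : 0 <= n%:R :> R by exact: ler0n.
have k20 : 0 <= kappa ^+ 2 / 2 by rewrite divr_ge0 ?sqr_ge0.
rewrite -mulrN -mulrBr; apply: ler_wpM2l => //.
have := ler_wpM2l k20 Pt; rewrite mulr1.
by lra.
Qed.

End gauss_density.

(** * Converse *)

Section error_functional.
Context {R : realType}.
Local Open Scope ereal_scope.

Definition det_error n K (P : R) sigma (c : det_code n K P) (m : 'I_K)
    (s j : n.-tuple R) : \bar R :=
  gauss_vec n sigma
    [set z | dec c (vadd (vadd (vadd (enc c m s) s) j) z) <> Some m].

Lemma measurable_det_error n K (P : R) sigma (Theta : rand_code n K P) m :
  measurable_fun [set: (rc_space Theta * n.-tuple R) * n.-tuple R]
    (fun u => det_error sigma (rc_code Theta u.1.1) m u.1.2 u.2).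
Proof.
pose f (v : ((rc_space Theta * n.-tuple R) * n.-tuple R) * n.-tuple R) :=
  (v.1.1.1, vadd (vadd (vadd (enc (rc_code Theta v.1.1.1) m v.1.1.2) v.1.1.2)
      v.1.2) v.2).
pose A := ~` (f @^-1` [set wy | dec (rc_code Theta wy.1) wy.2 = Some m]).
have mf : measurable_fun [set: ((rc_space Theta * n.-tuple R) * n.-tuple R) * n.-tuple R] f.
  have m11 : measurable_fun [set: ((rc_space Theta * n.-tuple R) * n.-tuple R) * n.-tuple R]
      (fun v => v.1.1).
    by apply: measurableT_comp.
  apply/measurable_fun_pairP; split => /=.
    exact: (measurableT_comp measurable_fst m11).
  apply: measurable_vadd => //; apply: measurable_vadd; last first.
    by apply: measurableT_comp.
  apply: measurable_vadd; last exact: (measurableT_comp measurable_snd m11).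
  exact: (measurableT_comp (measurable_rc_enc (r := Theta) m) m11).
have mA : measurable A.
  apply: measurableC; rewrite -[X in measurable X]setTI; apply: mf => //.
  exact: measurable_rc_dec.
have := measurable_fun_xsection (gauss_vec n sigma) mA.
apply: eq_measurable_fun => u _ /=; rewrite /det_error; congr (gauss_vec n sigma _).
by apply/seteqP; split => z; rewrite /xsection /= inE.
Qed.

Lemma measurable_det_error_set n K (P : R) (c : det_code n K P) m s j :
  measurable [set z | dec c (vadd (vadd (vadd (enc c m s) s) j) z) <> Some m].
Proof.
apply: measurableC.
rewrite -[X in measurable X]setTI.
apply: (@measurable_vadd _ _ _ _ (cst (vadd (vadd (enc c m s) s) j)) id _ _ _ [set y | dec c y = Some m]) => //.
exact: measurable_dec.
Qed.

Lemma error_probE n K (P : R) sigma sigmaS (Theta : rand_code n K P) m Q :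
  error_prob sigma sigmaS Theta m Q =
  \int[rc_law Theta]_w \int[gauss_vec n sigmaS]_s \int[Q s]_j
    det_error sigma (rc_code Theta w) m s j.
Proof. by []. Qed.

Lemma det_error_ge0 n K (P : R) sigma (c : det_code n K P) m s j :
  0 <= det_error sigma c m s j.
Proof. exact: measure_ge0. Qed.

Lemma error_prob_le_max n K (P L : R) sigma sigmaS (Theta : rand_code n K P) m
    (Q : R.-pker n.-tuple R ~> n.-tuple R) :
  (forall s, Q s (power_ball L) = 1) ->
  error_prob sigma sigmaS Theta m Q <= max_error_prob L sigma sigmaS Theta.
Proof.
move=> Q1.
pose F (m : 'I_K) := ereal_sup [set error_prob sigma sigmaS Theta m Q
              | Q in [set Q : R.-pker n.-tuple R ~> n.-tuple R |
                       forall s, Q s (power_ball L) = 1]].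
apply: (@le_trans _ _ (F m)); first by apply: ereal_sup_ubound; exists Q.
by rewrite /max_error_prob; apply: (le_bigmax_cond _ F).
Qed.

Lemma ge_integral_cst d (T : measurableType d) (P : probability T R) (a : R)
    (f : T -> \bar R) : (0 <= a)%R -> measurable_fun [set: T] f ->
  (forall x, a%:E <= f x) -> a%:E <= \int[P]_x f x.
Proof.
move=> a0 mf af.
have -> : a%:E = \int[P]_x (a%:E).
  by rewrite integral_cst//= probability_setT mule1.
by apply: ge0_le_integral => // x _; rewrite lee_fin.
Qed.

(** The jammer ignores message and state and draws from [nu]. The maximum over messages is at least
    the average, and a lower bound valid for every deterministic code and every state survives
    averaging over both. *)
Lemma max_error_ge_average n K (P L : R) sigma sigmaS (Theta : rand_code n K P)
    (nu : probability (n.-tuple R) R) (a e : R) : (0 <= a)%R ->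
  nu (power_ball L) = 1 ->
  (forall (c : det_code n K P) s, a%:E <= \sum_(m < K) \int[nu]_j det_error sigma c m s j) ->
  max_error_prob L sigma sigmaS Theta < e%:E -> (a <= K%:R * e)%R.
Proof.
move=> a0 nu1 H maxe.
pose Q : R.-pker n.-tuple R ~> n.-tuple R :=
  kprobability (@measurable_cst _ _ (n.-tuple R) (pprobability (n.-tuple R) R) setT nu).
have Q1 s : Q s (power_ball L) = 1 by [].
have QE m : error_prob sigma sigmaS Theta m Q =
    \int[rc_law Theta]_w \int[gauss_vec n sigmaS]_s \int[nu]_j
      det_error sigma (rc_code Theta w) m s j by [].
have mI m : measurable_fun [set: rc_space Theta * n.-tuple R]
    (fun ws => \int[nu]_j det_error sigma (rc_code Theta ws.1) m ws.2 j).
  apply: (measurable_fun_fubini_tonelli_F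
    (fun u : (rc_space Theta * n.-tuple R) * n.-tuple R =>
       det_error sigma (rc_code Theta u.1.1) m u.1.2 u.2)).
    exact: measurable_det_error.
  by move=> u; exact: det_error_ge0.
have mIw w m : measurable_fun [set: n.-tuple R]
    (fun s => \int[nu]_j det_error sigma (rc_code Theta w) m s j).
  exact: (measurableT_comp (mI m) (measurable_pair1 w)).
have I0 m w s : 0 <= \int[nu]_j det_error sigma (rc_code Theta w) m s j.
  by apply: integral_ge0 => j _; exact: det_error_ge0.
rewrite -lee_fin.
apply: (@le_trans _ _ (\sum_(m < K) error_prob sigma sigmaS Theta m Q)); last first.
  have -> : (K%:R * e)%:E = \sum_(m < K) e%:E.
    by rewrite sumEFin sumr_const card_ord mulr_natl.
  apply: lee_sum => m _; apply: le_trans (ltW maxe).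
  exact: error_prob_le_max.
under eq_bigr do rewrite QE.
rewrite -ge0_integral_sum//; last 2 first.
- by move=> m; apply: (measurable_fun_fubini_tonelli_F _ (mI m)) => u.
- by move=> m w _; apply: integral_ge0.
apply: ge_integral_cst => //.
  apply: emeasurable_sum => m.
  by apply: (measurable_fun_fubini_tonelli_F _ (mI m)) => u.
move=> w; rewrite -ge0_integral_sum//.
apply: ge_integral_cst => //; first by apply: emeasurable_sum => m; exact: mIw.
Qed.

End error_functional.

(** * Lower bounds on the error summed over the messages *)

Section converse_bounds.
Context {R : realType}.

Definition vzero n : n.-tuple R := [tuple 0 | i < n].

(** Moving the state to the end turns it into a translation of the decision regions; a decoder that
    knows the state is thereby covered at no cost. *)
Lemma vaddACs n (x s g z : n.-tuple R) :
  vadd (vadd (vadd x s) g) z = vadd (vadd (vadd x g) z) s.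
Proof.
by rewrite -(vaddA x s) (vaddC s) vaddA -(vaddA _ s) (vaddC s) vaddA.
Qed.

Lemma measurable_dec_shift n K (P : R) (c : det_code n K P) m s :
  measurable [set y | dec c (vadd y s) = Some m].
Proof.
rewrite -[X in measurable X]setTI.
apply: (@measurable_vadd _ _ _ _ id (cst s) _ _ _ [set y | dec c y = Some m]) => //.
exact: measurable_dec.
Qed.

(** Outside the ball any admissible vector would do as the default: that event is charged in full by
    the term [n%:R * L < sqnorm g] of the next bounds. *)
Definition trunc (L : R) n (g : n.-tuple R) : n.-tuple R :=
  if sqnorm g <= n%:R * L then g else vzero n.

Lemma measurable_trunc L n : measurable_fun [set: n.-tuple R] (@trunc L n).
Proof.
apply: measurable_fun_ifT => //; apply: measurable_fun_ler => //.
exact: measurable_sqnorm.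
Qed.

HB.instance Definition _ L n :=
  isMeasurableFun.Build _ _ _ _ (@trunc L n) (@measurable_trunc L n).

Lemma vadd0r n (x : n.-tuple R) : vadd x (vzero n) = x.
Proof. by apply: eq_from_tnth => i; rewrite !tnth_mktuple addr0. Qed.

Lemma sqnorm0 n : sqnorm (vzero n) = 0.
Proof. by apply: big1 => i _; rewrite tnth_mktuple expr0n. Qed.

Lemma trunc_ball L n (g : n.-tuple R) : 0 <= L -> power_ball L (trunc L g).
Proof.
move=> L0; rewrite /power_ball /= /trunc; case: ifP => // _.
by rewrite sqnorm0 mulr_ge0.
Qed.

Definition gauss_trunc n (u L : R) : probability (n.-tuple R) R :=
  distribution (gauss_vec n u) (@trunc L n).

Lemma gauss_trunc_ball n u L : 0 <= L -> gauss_trunc n u L (power_ball L) = 1%E.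
Proof.
move=> L0; rewrite -[LHS]/(gauss_vec n u (@trunc L n @^-1` power_ball L)).
rewrite (_ : _ @^-1` _ = setT) ?probability_setT//.
by apply/seteqP; split => // g _; exact: trunc_ball.
Qed.

Lemma sum_measure_disjoint_le1 d (T : measurableType d) (mu : probability T R) K
    (D : 'I_K -> set T) : (forall m, measurable (D m)) -> trivIset setT D ->
  (\sum_(m < K) mu (D m) <= 1)%E.
Proof.
move=> mD tD; rewrite -measure_bigsetU_ord//; apply: probability_le1.
exact: bigsetU_measurable.
Qed.

(** Pointwise in the Gaussian draw [g]: inside the ball, error and success add up to one, and
    outside it the indicator alone is one. The success term is then bounded by hypothesis testing
    against N(0, t^2), jamming and noise having merged into variance [v ^+ 2]. *)
Lemma gauss_success n K (P L kappa sigma u t v : R) (c : det_code n K P) s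
    (m : 'I_K) : 0 < sigma -> 0 < u -> 0 < v -> 0 < t -> 0 < P -> 0 < kappa ->
  v ^+ 2 = u ^+ 2 + sigma ^+ 2 -> t ^+ 2 = P + v ^+ 2 ->
  (1 <= \int[gauss_trunc n u L]_j det_error sigma c m s j +
   ((expR (n%:R * (ln (t / v) + kappa)))%:E *
      gauss_vec n t [set y | dec c (vadd y s) = Some m] +
   (expR (- (n%:R * (kappa ^+ 2 / 2))))%:E) +
   gauss_vec n u [set g | (n%:R * L < sqnorm g)%R])%E.
Proof.
move=> s0 u0 v0 t0 P0 k0 vE tE.
set D := [set y | _]; set E := [set g | _].
have mD : measurable D by exact: measurable_dec_shift.
have mE : measurable E.
  apply: measurable_setb; apply: measurable_fun_ltr => //.
  exact: measurable_sqnorm.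
pose good g := (\int[gauss_vec n sigma]_z
  (\1_D (vadd (vadd (enc c m s) g) z))%:E)%E.
have mgood2 : measurable_fun [set: n.-tuple R * n.-tuple R]
    (fun v => (\1_D (vadd (vadd (enc c m s) v.1) v.2) : R)%:E).
  apply/measurable_EFinP; apply: (measurableT_comp (measurable_indic mD)).
  by apply: measurable_vadd => //; exact: measurable_vadd.
have mgood : measurable_fun [set: n.-tuple R] good.
  by apply: (measurable_fun_fubini_tonelli_F _ mgood2).
have good0 g : (0 <= good g)%E by apply: integral_ge0.
have goodE g : (det_error sigma c m s g = 1 - good g)%E.
  pose A := vadd (vadd (enc c m s) g) @^-1` D.
  have mA : measurable A.
    by rewrite -[A]setTI; apply: (@measurable_vadd _ _ _ _ (cst _) id).
  have -> : good g = gauss_vec n sigma A.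
    by rewrite /good -[A]setIT -integral_indic.
  rewrite -probability_setC//; congr (gauss_vec n sigma _).
  by apply/seteqP; split => z; rewrite /A /D /= (vaddACs (enc c m s) s).
have mde : measurable_fun [set: n.-tuple R] (fun j => det_error sigma c m s j).
  by under eq_fun do rewrite goodE; exact: emeasurable_funB.
have good1 g : (good g <= 1)%E.
  rewrite -[leRHS](probability_setT (gauss_vec n sigma)) -[leRHS]mul1e.
  rewrite -(integral_cst (gauss_vec n sigma) measurableT).
  apply: ge0_le_integral => //.
  - apply/measurable_EFinP; apply: (measurableT_comp (measurable_indic mD)).
    exact: measurable_vadd.
  - by move=> z _; rewrite lee_fin indicE lern1 leq_b1.
have H1 : (1 <= \int[gauss_vec n u]_g (det_error sigma c m s (trunc L g) + good g + (\1_E g)%:E))%E.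
  apply: ge_integral_cst => //.
    apply: emeasurable_funD; last by apply/measurable_EFinP; exact: measurable_indic.
    apply: emeasurable_funD => //; apply: (measurableT_comp mde).
    exact: measurable_trunc.
  move=> g; rewrite /trunc indicE; case: (boolP (g \in E)) => gE.
    by rewrite leeDr// adde_ge0// det_error_ge0.
  have -> : sqnorm g <= n%:R * L.
    by move: gE; rewrite notin_setE /E /= => /negP; rewrite -leNgt.
  by rewrite adde0 goodE subeK// ge0_fin_numE// (le_lt_trans (good1 g))// ltry.
apply: (le_trans H1).
rewrite ge0_integralD//; last 2 first.
- apply: emeasurable_funD => //; apply: (measurableT_comp mde).
  exact: measurable_trunc.
- by apply/measurable_EFinP; exact: measurable_indic.
rewrite integral_indic// setIT leeD2r// ge0_integralD//; last first.
  by apply: (measurableT_comp mde); exact: measurable_trunc.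
apply: leeD; first by rewrite /gauss_trunc ge0_integral_distribution.
rewrite (@integral_gauss_vec_conv _ n sigma t u v _ (fun y => (\1_D y)%:E))//.
- by apply: (@gauss_success_bound _ n v t P kappa) => //; exact: enc_power.
- by apply/measurable_EFinP; exact: measurable_indic.
- by move=> g _; rewrite adde_ge0// det_error_ge0.
Qed.


(** The decision regions are disjoint, so their masses under the common law N(0, t^2) sum to at most
    one: the large factor is paid once and not [K] times. *)
Lemma det_error_sum_large n K (P L kappa sigma u t v p : R)
    (c : det_code n K P) s :
  0 < sigma -> 0 < u -> 0 < v -> 0 < t -> 0 < P -> 0 < kappa ->
  v ^+ 2 = u ^+ 2 + sigma ^+ 2 -> t ^+ 2 = P + v ^+ 2 ->
  (gauss_vec n u [set g | (n%:R * L < sqnorm g)%R] <= p%:E)%E ->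
  ((K%:R * (1 - p - expR (- (n%:R * (kappa ^+ 2 / 2)))) -
     expR (n%:R * (ln (t / v) + kappa)))%:E <=
   \sum_(m < K) \int[gauss_trunc n u L]_j det_error sigma c m s j)%E.
Proof.
move=> s0 u0 v0 t0 P0 k0 vE tE pE.
set e1 := expR (n%:R * (ln (t / v) + kappa)).
set e2 := expR (- (n%:R * (kappa ^+ 2 / 2))).
pose D (m : 'I_K) := [set y | dec c (vadd y s) = Some m].
have mD m : measurable (D m) by exact: measurable_dec_shift.
have tD : trivIset setT D.
  apply/trivIsetP => i j _ _ /eqP ij; apply/seteqP; split => // y [].
  by rewrite /D /= => Di Dj; apply: ij; move: Di; rewrite Dj => -[].
have := sum_measure_disjoint_le1 (gauss_vec n t) mD tD.
have fG m : gauss_vec n t (D m) = (fine (gauss_vec n t (D m)))%:E.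
  by rewrite fineK// fin_num_measure.
under eq_bigr do rewrite fG.
rewrite sumEFin lee_fin => r1.
apply: (@le_trans _ _ (\sum_(m < K)
   (1 - p - e2 - e1 * fine (gauss_vec n t (D m)))%:E)%E).
  rewrite sumEFin lee_fin sumrB -mulr_sumr sumr_const card_ord.
  rewrite -[X in _ <= X - _]mulr_natl lerD2l lerN2.
  by rewrite -[leRHS]mulr1 ler_wpM2l// expR_ge0.
apply: lee_sum => m _.
have := gauss_success L c s m s0 u0 v0 t0 P0 k0 vE tE.
rewrite -/e1 -/e2 fG -EFinM -EFinD => H.
have {}H := le_trans H (leeD2l _ pE).
rewrite -addeA -EFinD in H.
rewrite -leeBlDr// -EFinB in H.
by apply: le_trans H; rewrite lee_fin; lra.
Qed.

Lemma det_error_indic n K (P sigma : R) (c : det_code n K P) m s j :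
  det_error sigma c m s j = (\int[gauss_vec n sigma]_z
    (\1_(~` [set y | dec c (vadd y s) = Some m])
       (vadd (vadd (enc c m s) j) z))%:E)%E.
Proof.
set D := ~` _.
have mD : measurable D by apply: measurableC; exact: measurable_dec_shift.
pose A := vadd (vadd (enc c m s) j) @^-1` D.
have mA : measurable A.
  by rewrite -[A]setTI; apply: (@measurable_vadd _ _ _ _ (cst _) id).
transitivity (gauss_vec n sigma A); last by rewrite -[A]setIT -integral_indic.
by congr (gauss_vec n sigma _); apply/seteqP; split => z; rewrite /A /D /= (vaddACs (enc c m s) s).
Qed.

(** Halving the variance of the reference law makes the difference of the exponents the perfect
    square [(x + y)^2 / (2 s^2)], so the bound is uniform in [y], and in [x] under the power
    constraint. *)
Lemma gauss_vec_ratio_ge n (P s t : R) (x y : n.-tuple R) : 0 < s -> 0 < t ->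
  t ^+ 2 *+ 2 = s ^+ 2 -> sqnorm x <= n%:R * P ->
  (t / s * expR (- (P / s ^+ 2))) ^+ n <= gauss_vec_ratio s t x y.
Proof.
move=> s0 t0 ts xP; have s20 : 0 < s ^+ 2 by exact: exprn_gt0.
apply: (@le_trans _ _ (\prod_(i < n) (t / s * expR (- (tnth x i ^+ 2 / s ^+ 2))))).
  rewrite big_split /= prodr_const card_ord exprMn ler_pM2l; last first.
    by rewrite exprn_gt0// divr_gt0.
  rewrite -expR_sum -expRM_natl ler_expR sumrN -mulr_suml mulrN lerN2.
  by rewrite mulrA ler_pM2r// invr_gt0.
apply: ler_prod => i _; rewrite mulr_ge0 ?expR_ge0 ?divr_ge0 ?(ltW s0) ?(ltW t0)//=.
rewrite /gauss_ratio ler_pM2l ?divr_gt0// ler_expR ts -subr_ge0.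
set a := tnth x i; set b := tnth y i.
have -> : b ^+ 2 / s ^+ 2 - (b - a) ^+ 2 / (s ^+ 2 *+ 2) - - (a ^+ 2 / s ^+ 2) =
   (b + a) ^+ 2 / (s ^+ 2 *+ 2).
  by field; rewrite gt_eqF.
by rewrite divr_ge0 ?sqr_ge0// mulrn_wge0// ltW.
Qed.

(** The complements of two disjoint decision regions cover the space, so under the common law N(0,
    t^2) their masses sum to at least one. The Dirac mass at zero is a silent jammer. *)
Lemma det_error_sum_small n K (P sigma t : R) (c : det_code n K P) s :
  0 < sigma -> 0 < t -> t ^+ 2 *+ 2 = sigma ^+ 2 -> (1 < K)%N ->
  (((t / sigma * expR (- (P / sigma ^+ 2))) ^+ n)%:E <=
   \sum_(m < K) \int[\d_(vzero n)]_j det_error sigma c m s j)%E.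
Proof.
move=> s0 t0 ts K1.
set q := _ ^+ n; set z0 := vzero n.
have q0 : 0 <= q by rewrite exprn_ge0// mulr_ge0 ?expR_ge0// divr_ge0 ?ltW.
pose D (m : 'I_K) := [set y | dec c (vadd y s) = Some m].
have mD m : measurable (D m) by exact: measurable_dec_shift.
have mDC m : measurable (~` D m) by exact: measurableC.
have Hm m : (q%:E * gauss_vec n t (~` D m) <=
    \int[\d_z0]_j det_error sigma c m s j)%E.
  have mde : measurable_fun [set: n.-tuple R] (fun j => det_error sigma c m s j).
    under eq_fun do rewrite det_error_indic.
    apply: (measurable_fun_fubini_tonelli_F (fun v : n.-tuple R * n.-tuple R =>
      (\1_(~` D m) (vadd (vadd (enc c m s) v.1) v.2) : R)%:E)) => //.
    apply/measurable_EFinP; apply: (measurableT_comp (measurable_indic (mDC m))).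
    by apply: measurable_vadd => //; exact: measurable_vadd.
  rewrite integral_dirac// diracT mul1e det_error_indic vadd0r.
  rewrite (@integral_gauss_vec_shift _ n sigma t _ (fun y => (\1_(~` D m) y)%:E))//; last first.
    by apply/measurable_EFinP; exact: measurable_indic.
  rewrite -[X in gauss_vec n t X]setIT -integral_indic// -ge0_integralZl//; last first.
    by apply/measurable_EFinP; exact: measurable_indic.
  apply: ge0_le_integral => //.
  - by move=> y _; rewrite mule_ge0// lee_fin.
  - by apply: measurable_funeM; apply/measurable_EFinP; exact: measurable_indic.
  - apply: emeasurable_funM; first by apply/measurable_EFinP; exact: measurable_indic.
    by apply/measurable_EFinP; exact: measurable_gauss_vec_ratio.
  - move=> y _; rewrite muleC lee_wpmul2l// lee_fin gauss_vec_ratio_ge//.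
    exact: enc_power.
pose i0 : 'I_K := Ordinal (ltnW K1); pose i1 : 'I_K := Ordinal K1.
rewrite (bigD1 i0)//= (bigD1 i1)//=.
have H : (q%:E <= q%:E * gauss_vec n t (~` D i0) + q%:E * gauss_vec n t (~` D i1))%E.
  rewrite -muleDr//; last first.
    by rewrite ge0_adde_def// inE.
  rewrite -[leLHS]mule1 lee_wpmul2l// -(probability_setT (gauss_vec n t)).
  apply: le_trans (measureU2 _ _ _) => //.
  apply: le_measure; rewrite ?inE//; first exact: measurableU.
  move=> y _ /=; rewrite /D /= -not_andP => -[->].
  by move=> /Some_inj /(congr1 val).
apply: (le_trans H); rewrite addeA; apply: (@le_trans _ _ (\int[\d_z0]_j det_error sigma c i0 s j + \int[\d_z0]_j det_error sigma c i1 s j)%E).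
  exact: leeD.
rewrite leeDl// sume_ge0// => i _; apply: integral_ge0 => j _.
exact: det_error_ge0.
Qed.

End converse_bounds.

Section converse.
Context {R : realType}.

Lemma expr_eventually_le (q d : R) : 0 <= q < 1 -> 0 < d ->
  exists N, forall n, (N <= n)%N -> q ^+ n <= d.
Proof.
move=> /andP[q0 q1] d0.
have /cvgrPdist_le/(_ _ d0)[N _ HN] : (fun n => q ^+ n) @ \oo --> (0 : R).
  by apply: cvg_expr; rewrite ger0_norm.
exists N => n Nn; have := HN n Nn.
by rewrite sub0r normrN ger0_norm// exprn_ge0.
Qed.

Lemma achievable_le_capacity (P L sigma sigmaS r : R) :
  0 < P -> 0 < L -> 0 < sigma -> achievable P L sigma sigmaS r ->
  r <= 2^-1 * log2 (1 + P / (L + sigma ^+ 2)).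
Proof.
move=> P0 L0 s0 ach; rewrite leNgt; apply/negP => rC.
have l2 : 0 < ln 2 :> R by rewrite ln_gt0// ltr1n.
have s20 : 0 < sigma ^+ 2 by exact: exprn_gt0.
have N0 : 0 < L + sigma ^+ 2 by lra.
have PN0 : 0 < P / (L + sigma ^+ 2) by exact: divr_gt0.
have rC2 : ln (1 + P / (L + sigma ^+ 2)) < 2 * (r * ln 2).
  move: rC; rewrite -(ltr_pM2r l2) /log2 -mulrA divfK ?gt_eqF//.
  by rewrite ltr_pdivrMl.
have r0 : 0 < r * ln 2.
  rewrite -(pmulr_rgt0 _ (ltr0n R 2)); apply: lt_trans rC2.
  by rewrite ln_gt0// ltrDl.
(* [q] is [2^(2 r) - 1], the signal-to-noise ratio at which [r] would be the capacity. A rate above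
   capacity means [P / q < L + sigma ^+ 2]. *)
pose q := expR (2 * (r * ln 2)) - 1.
have qE : expR (2 * (r * ln 2)) = 1 + q by rewrite /q addrC subrK.
have Pq : P / (L + sigma ^+ 2) < q.
  rewrite -(ltrD2l 1) -qE -[ltLHS]lnK ?ltr_expR// posrE; lra.
have q0 : 0 < q by lra.
have Pq' : P / q < L + sigma ^+ 2 by rewrite ltr_pdivrMr// mulrC -ltr_pdivrMr.
(* Above [P / q], so that [r] still exceeds the capacity at noise [w]; above [sigma ^+ 2], so that
   the jammer has positive variance; below [L + sigma ^+ 2], so that truncation is rare. *)
pose w := (Num.max (P / q) (sigma ^+ 2) + (L + sigma ^+ 2)) / 2.
have [w1 w2 w3] : [/\ P / q < w, sigma ^+ 2 < w & w < L + sigma ^+ 2].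
  have m1 : P / q <= Num.max (P / q) (sigma ^+ 2) by rewrite le_max lexx.
  have m2 : sigma ^+ 2 <= Num.max (P / q) (sigma ^+ 2) by rewrite le_max lexx orbT.
  have m3 : Num.max (P / q) (sigma ^+ 2) < L + sigma ^+ 2.
    by rewrite gt_max Pq'/=; lra.
  by rewrite /w; split; lra.
have w0 : 0 < w by lra.
pose v := Num.sqrt w; pose u := Num.sqrt (w - sigma ^+ 2); pose t := Num.sqrt (P + w).
have v0 : 0 < v by rewrite sqrtr_gt0.
have u0 : 0 < u by rewrite sqrtr_gt0; lra.
have t0 : 0 < t by rewrite sqrtr_gt0; lra.
have v2 : v ^+ 2 = w by rewrite sqr_sqrtr// ltW.
have u2 : u ^+ 2 = w - sigma ^+ 2 by rewrite sqr_sqrtr//; lra.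
have t2 : t ^+ 2 = P + w by rewrite sqr_sqrtr//; lra.
have vE : v ^+ 2 = u ^+ 2 + sigma ^+ 2 by lra.
have tE : t ^+ 2 = P + v ^+ 2 by lra.
have tv : ln (t / v) < r * ln 2.
  rewrite -(ltr_pM2l (ltr0n R 2)) mulr_natl -lnXn ?divr_gt0//.
  rewrite exprMn exprVn v2 t2 -ltr_expR lnK ?qE; last first.
    by rewrite posrE divr_gt0//; lra.
  rewrite mulrDl divff ?gt_eqF// addrC ltrD2l ltr_pdivrMr// mulrC.
  by rewrite -ltr_pdivrMr.
(* Half the gap: [ln (t / v) + kappa] is then [r * ln 2 - kappa], and the testing factor is [K]
   times [expR (- kappa) ^+ n]. *)
pose kappa := (r * ln 2 - ln (t / v)) / 2.
have k0 : 0 < kappa by rewrite /kappa; lra.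
have [rho rho01 Hrho] := @gauss_tail R u 0 L u0 (lexx 0) ltac:(lra).
have sixth : 0 < 6^-1 :> R by rewrite invr_gt0.
have rho01' : 0 <= rho < 1 by case/andP: rho01 => /ltW -> ->.
have [N1 H1] := expr_eventually_le rho01' sixth.
have e201 : 0 <= expR (- (kappa ^+ 2 / 2)) < 1.
  by rewrite expR_ge0 expR_lt1 oppr_lt0 divr_gt0 ?exprn_gt0.
have [N2 H2] := expr_eventually_le e201 sixth.
have e301 : 0 <= expR (- kappa) < 1 by rewrite expR_ge0 expR_lt1 oppr_lt0.
have [N3 H3] := expr_eventually_le e301 sixth.
pose n0 := maxn N1 (maxn N2 N3).
pose tp := sigma / Num.sqrt 2.
have sq2 : 0 < Num.sqrt 2 :> R by rewrite sqrtr_gt0.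
have tp0 : 0 < tp by exact: divr_gt0.
have tpE : tp ^+ 2 *+ 2 = sigma ^+ 2.
  by rewrite /tp exprMn exprVn sqr_sqrtr// -mulr_natr; field.
pose cq := tp / sigma * expR (- (P / sigma ^+ 2)).
have cq0 : 0 < cq by rewrite mulr_gt0 ?expR_gt0// divr_gt0.
have cq1 : cq <= 1.
  rewrite /cq mulr_ile1 ?expR_ge0 ?(ltW (divr_gt0 _ _))//.
    rewrite ler_pdivrMr// mul1r /tp ler_pdivrMr// ler_peMr ?(ltW s0)//.
    by rewrite -[leLHS]sqrtr1 ler_wsqrtr// ler1n.
  by rewrite expR_le1 oppr_le0 divr_ge0 ?ltW.
pose E0 := expR (n0%:R * (r * ln 2)).
have E00 : 0 < E0 by exact: expR_gt0.
(* The second entry rules out lengths below [n0]: there [K <= E0], so the summed error would be at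
   most [cq ^+ n0 / 2], whereas it is at least [cq ^+ n]. *)
pose delta := Num.min 4^-1 (cq ^+ n0 / (2 * E0)).
have d0 : 0 < delta.
  by rewrite /delta lt_min invr_gt0 ltr0n/= divr_gt0 ?exprn_gt0// mulr_gt0.
have [n [K [n_gt0 KE [code Hcode]]]] := ach delta d0.
have {}KE : K%:R = expR (n%:R * (r * ln 2)) :> R.
  by rewrite KE /powR gt_eqF// mulrA.
have n_gt0R : 0 < n%:R :> R by rewrite ltr0n.
have K1 : (1 < K)%N by rewrite -(ltr1n R) KE expR_gt1 mulr_gt0.
have K0 : 0 < K%:R :> R by rewrite KE expR_gt0.
have [n0n|nn0] := leqP n0 n.
  have tail : (gauss_vec n u [set g | (n%:R * L < sqnorm g)%R] <= (rho ^+ n)%:E)%E.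
    have := Hrho n (vzero n); rewrite mulr0 sqnorm0 lexx => /(_ isT).
    rewrite (_ : [set z | _] = [set g | n%:R * L < sqnorm g])//.
    by apply/seteqP; split => g /=; rewrite vaddC vadd0r.
  have := max_error_ge_average _ (gauss_trunc_ball n u (ltW L0))
    (fun c s => det_error_sum_large c s s0 u0 v0 t0 P0 k0 vE tE tail) Hcode.
  have -> : n%:R * (ln (t / v) + kappa) = n%:R * (r * ln 2) + n%:R * (- kappa).
    by rewrite -mulrDr; congr (_ * _); rewrite /kappa; lra.
  rewrite expRD -KE -mulrN !expRM_natl -mulrBr.
  move: n0n; rewrite /n0 !geq_max => /and3P[n1 n2 n3].
  have h1 := H1 _ n1; have h2 := H2 _ n2; have h3 := H3 _ n3.
  have dd : delta <= 4^-1 by rewrite ge_min lexx.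
  move=> H; have {}H := H ltac:(apply: mulr_ge0; [exact: ltW|lra]).
  by move: H; rewrite ler_pM2l//; lra.
have nu1 : (\d_(vzero n) : probability _ R) (power_ball L) = 1%E.
  rewrite /= diracE mem_set// /power_ball /= sqnorm0.
  by rewrite mulr_ge0 ?ltW.
have := max_error_ge_average _ nu1
    (fun c s => det_error_sum_small c s s0 tp0 tpE K1) Hcode.
rewrite -/cq => /(_ (exprn_ge0 _ (ltW cq0))).
apply/negP; rewrite -ltNge.
have KE0 : K%:R <= E0.
  by rewrite KE ler_expR ler_pM2r// ler_nat ltnW.
apply: (@le_lt_trans _ _ (E0 * (cq ^+ n0 / (2 * E0)))).
  apply: ler_pM => //; first exact: ltW.
  by rewrite ge_min lexx orbT.
have -> : E0 * (cq ^+ n0 / (2 * E0)) = cq ^+ n0 / 2.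
  by field; rewrite gt_eqF.
apply: (@lt_le_trans _ _ (cq ^+ n0)); last first.
  by apply: ler_wiXn2l; [exact: ltW|exact: cq1|exact: ltnW].
by rewrite ltr_pdivrMr// ltr_pMr ?exprn_gt0// ltr1n.
Qed.

End converse.

(** * Uniform points of a torus *)

Lemma iid_prob_tnth d (T : measurableType d) (R : realType)
    (mu : probability T R) n (i : 'I_n) (A : set T) : measurable A ->
  iid_prob mu n [set x | A (tnth x i)] = mu A.
Proof.
move=> mA.
have mt : measurable_fun [set: n.-tuple T] (@tnth n T ^~ i).
  exact: measurable_tnth.
have mAi : measurable [set x : n.-tuple T | A (tnth x i)].
  rewrite -[X in measurable X]setTI.
  rewrite (_ : [set x : n.-tuple T | A (tnth x i)] = (@tnth n T ^~ i) @^-1` A)//.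
  exact: mt.
rewrite -[A in RHS]setTI setIC -integral_indic// -(integral_iid_tnth mu i)//.
- rewrite -[X in _ X = _]setIT -integral_indic//.
- by apply/measurable_EFinP; exact: measurable_indic.
Qed.

Section torus.
Context {R : realType}.

Definition unif_vec n : probability (n.-tuple R) R := iid_prob unif n.

Definition smul n (c : R) (x : n.-tuple R) : n.-tuple R :=
  [tuple c * tnth x i | i < n].

(* [tmod b u a] is the representative of [b u - a] modulo the lattice
   [b Z^n] in the centered cube of side [b]. *)
Definition tmod n (b : R) (u a : n.-tuple R) : n.-tuple R :=
  [tuple b * cfrac (tnth u i - tnth a i / b) | i < n].

(** [r] is a squared radius. Once the ball fits into the cube of side [b], this is its volume
    divided by [b ^+ n]. *)
Definition ball_prob n (b r : R) : R :=
  fine (unif_vec n [set u | sqnorm (smul b u) <= r]).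

Lemma measurable_smul d (T : measurableType d) n c (f : T -> n.-tuple R) :
  measurable_fun [set: T] f -> measurable_fun [set: T] (fun x => smul c (f x)).
Proof.
move=> mf; apply: (measurable_tuple (f := fun i x => c * tnth (f x) i)) => i.
apply: measurable_funM => //.
exact: (measurableT_comp (@measurable_tnth _ R n i) mf).
Qed.

Lemma measurable_tmod d (T : measurableType d) n b (f g : T -> n.-tuple R) :
  measurable_fun [set: T] f -> measurable_fun [set: T] g ->
  measurable_fun [set: T] (fun x => tmod b (f x) (g x)).
Proof.
move=> mf mg; apply: (measurable_tuple
  (f := fun i x => b * cfrac (tnth (f x) i - tnth (g x) i / b))) => i.
have mt := @measurable_tnth _ R n i.
apply: measurable_funM => //; apply: (measurableT_comp measurable_cfrac).
apply: measurable_funB; first exact: (measurableT_comp mt mf).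
by apply: measurable_funM => //; exact: (measurableT_comp mt mg).
Qed.

Lemma measurable_sqnorm_le d (T : measurableType d) n r (f : T -> n.-tuple R) :
  measurable_fun [set: T] f ->
  measurable_fun [set: T] (fun x => sqnorm (f x) <= r).
Proof.
move=> mf; apply: measurable_fun_ler => //.
exact: (measurableT_comp (@measurable_sqnorm R n) mf).
Qed.

Lemma integral_unif_vec_tmod n b (a : n.-tuple R) (F : n.-tuple R -> \bar R) :
  measurable_fun [set: n.-tuple R] F -> (forall x, 0 <= F x)%E ->
  (\int[unif_vec n]_u F (tmod b u a) = \int[unif_vec n]_u F (smul b u))%E.
Proof.
move=> mF F0.
have mG : measurable_fun [set: n.-tuple R] (fun u => F (smul b u)).
  by apply: (measurableT_comp mF); exact: measurable_smul.
have := @integral_iid_transfer _ _ _ _ _ (@unif R) unif n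
  (fun i u => cfrac (u - tnth a i / b)) (fun i y => 1) _ _ _ _ _ mG (fun u => F0 _).
move=> H; transitivity (\int[unif_vec n]_x
    F (smul b [tuple cfrac (tnth x i - tnth a i / b) | i < n]))%E.
  apply: eq_integral => u _; congr F; apply: eq_from_tnth => i.
  by rewrite !tnth_mktuple.
rewrite [LHS]H//.
- by apply: eq_integral => u _; rewrite big1// mule1.
- by move=> i; apply: (measurableT_comp measurable_cfrac); exact: measurable_funB.
- move=> i G mG' G0; under [RHS]eq_integral do rewrite mule1.
  exact: integral_unif_cfrac.
Qed.

Lemma ball_probE n b r :
  unif_vec n [set u | sqnorm (smul b u) <= r] = (ball_prob n b r)%:E.
Proof.
rewrite /ball_prob fineK// fin_num_measure//; apply: measurable_setb.
by apply: measurable_sqnorm_le; exact: measurable_smul.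
Qed.

Lemma ball_prob_ge0 n b r : 0 <= ball_prob n b r.
Proof. by rewrite /ball_prob fine_ge0. Qed.

Lemma ball_prob_le1 n b r : ball_prob n b r <= 1.
Proof.
rewrite -lee_fin -ball_probE; apply: probability_le1; apply: measurable_setb.
by apply: measurable_sqnorm_le; exact: measurable_smul.
Qed.

Lemma unif_vec_tmod n b r (a : n.-tuple R) :
  unif_vec n [set u | sqnorm (tmod b u a) <= r] = (ball_prob n b r)%:E.
Proof.
rewrite -ball_probE.
have mB : measurable [set x : n.-tuple R | sqnorm x <= r].
  by apply: measurable_setb; exact: measurable_sqnorm_le.
have mI : measurable_fun [set: n.-tuple R]
    (fun x => (\1_[set x : n.-tuple R | sqnorm x <= r] x : R)%:E).
  by apply/measurable_EFinP; exact: measurable_indic.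
have I0 (x : n.-tuple R) :
    (0 <= (\1_[set x : n.-tuple R | sqnorm x <= r] x : R)%:E)%E.
  by rewrite lee_fin.
have := integral_unif_vec_tmod b a mI I0.
have m1 : measurable [set u : n.-tuple R | sqnorm (tmod b u a) <= r].
  by apply: measurable_setb; apply: measurable_sqnorm_le; exact: measurable_tmod.
have m2 : measurable [set u : n.-tuple R | sqnorm (smul b u) <= r].
  by apply: measurable_setb; apply: measurable_sqnorm_le; exact: measurable_smul.
move=> H; rewrite -[X in _ X = _]setIT -[X in _ = _ X]setIT.
by rewrite -!integral_indic//; exact: H.
Qed.

(** Both vectors agree modulo the lattice and the left one is reduced. It turns nearness of a sent
    word to [- e] into membership of its codeword in a ball with a shifted centre. *)
Lemma tmod_shift_sqnorm_le n b (u a e : n.-tuple R) : 0 < b ->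
  sqnorm (tmod b u (vadd a (smul (-1) e))) <= sqnorm (vadd (tmod b u a) e).
Proof.
move=> b0; apply: ler_sum => i _; rewrite !tnth_mktuple.
set x := tnth u i; set y := tnth a i; set z := tnth e i.
have -> : cfrac (x - (y + -1 * z) / b) = cfrac (cfrac (x - y / b) + z / b).
  by rewrite cfracD; congr cfrac; field; rewrite gt_eqF.
apply: (@le_trans _ _ (b ^+ 2 * (cfrac (x - y / b) + z / b) ^+ 2)).
  by rewrite exprMn ler_pM2l ?exprn_gt0// cfrac_sqr_le.
rewrite -exprMn le_eqVlt; apply/orP; left; apply/eqP; congr (_ ^+ 2).
by field; rewrite gt_eqF.
Qed.

Lemma measurable_itv_indicator (l u : R) :
  measurable_fun [set: R] (fun x => (l <= x < u)%R%:R : R).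
Proof.
rewrite (_ : (fun x => _) = (fun x => if (l <= x < u)%R then 1 else 0)).
  apply: measurable_fun_ifT => //; apply: measurable_and => //.
  - exact: measurable_fun_ler.
  - exact: measurable_fun_ltr.
by apply/funext => y; case: ifP.
Qed.

(** The product is the density of [c x] for uniform [x], and [c x] lies in the ball of squared
    radius [c^2 r] exactly when [x] lies in that of squared radius [r]. *)
Lemma integral_ball_prob_scale n b r c : 0 < c <= 1 ->
  (\int[unif_vec n]_x ((\1_[set u | sqnorm (smul b u) <= c ^+ 2 * r] x)%:E *
     (\prod_(i < n) (c^-1 * (- (c / 2) <= tnth x i < c / 2)%R%:R))%:E) =
   (ball_prob n b r)%:E)%E.
Proof.
move=> c01; have /andP[c0 c1] := c01.
have c20 : 0 < c ^+ 2 by exact: exprn_gt0.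
set D := [set u | _].
have mD : measurable D.
  by apply: measurable_setb; apply: measurable_sqnorm_le; exact: measurable_smul.
have mI : measurable_fun [set: n.-tuple R] (fun x => (\1_D x : R)%:E).
  by apply/measurable_EFinP; exact: measurable_indic.
have I0 (x : n.-tuple R) : (0 <= (\1_D x : R)%:E)%E by rewrite lee_fin.
have H := @integral_iid_transfer _ _ _ _ _ (@unif R) unif n
  (fun i u => c * u) (fun i x => c^-1 * (- (c / 2) <= x < c / 2)%R%:R)
  _ _ _ _ _ mI I0.
rewrite -[LHS]H//.
- rewrite -ball_probE.
  have m2 : measurable [set u : n.-tuple R | sqnorm (smul b u) <= r].
    by apply: measurable_setb; apply: measurable_sqnorm_le; exact: measurable_smul.
  rewrite -[X in _ = _ X]setIT -integral_indic//.
  apply: eq_integral => x _; rewrite !indicE; congr (_%:R%:E); congr nat_of_bool.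
  rewrite /D; apply/idP/idP; rewrite !inE /= => xr.
    rewrite -(ler_pM2l c20); apply: le_trans xr; rewrite mulr_sumr.
    by apply: ler_sum => i _; rewrite !tnth_mktuple -exprMn mulrCA.
  rewrite -(ler_pM2l c20) in xr; apply: le_trans xr; rewrite mulr_sumr.
  by apply: ler_sum => i _; rewrite !tnth_mktuple -exprMn mulrCA.
- by move=> i; exact: measurable_funM.
- by move=> i; apply: measurable_funM => //; exact: measurable_itv_indicator.
- by move=> i y; rewrite mulr_ge0// invr_ge0 ltW.
- by move=> i F mF F0; exact: integral_unif_scale.
Qed.

(** The density of the contracted point is at most [c^-1] to the power [n]. *)
Lemma ball_prob_scale_le n b r c : 0 < c <= 1 ->
  c ^+ n * ball_prob n b r <= ball_prob n b (c ^+ 2 * r).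
Proof.
move=> c01; have /andP[c0 c1] := c01.
have cn : 0 < c ^+ n by exact: exprn_gt0.
rewrite mulrC -ler_pdivlMr// -lee_fin EFinM -(ball_probE n b (c ^+ 2 * r)).
rewrite -(integral_ball_prob_scale n b r c01).
set D := [set u | _].
have mD : measurable D.
  by apply: measurable_setb; apply: measurable_sqnorm_le; exact: measurable_smul.
rewrite -[D in leRHS]setIT -integral_indic// muleC -ge0_integralZl//; last 2 first.
- by apply/measurable_EFinP; exact: measurable_indic.
- by rewrite lee_fin invr_ge0 ltW.
apply: ge0_le_integral => //.
- move=> x _; rewrite mule_ge0 ?lee_fin// prodr_ge0// => i _.
  by rewrite mulr_ge0// invr_ge0 ltW.
- apply: emeasurable_funM; first by apply/measurable_EFinP; exact: measurable_indic.
  apply/measurable_EFinP/measurable_fun_bigprod => i.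
  apply: measurable_funM => //.
  apply: (measurableT_comp (@measurable_itv_indicator (- (c / 2)) (c / 2))).
  exact: measurable_tnth.
- by apply: measurable_funeM; apply/measurable_EFinP; exact: measurable_indic.
- move=> x _; rewrite muleC lee_wpmul2r ?lee_fin// -exprVn.
  rewrite -[X in _ <= _ ^+ X](card_ord n) -prodr_const.
  apply: ler_prod => i _; rewrite mulr_ge0 ?invr_ge0 ?(ltW c0)//=.
  by rewrite ler_piMr ?invr_ge0 ?(ltW c0)// lern1 leq_b1.
Qed.

(** For [r < b^2 / 4] the contracted ball lies inside the contracted cube, where the density equals
    its maximum. *)
Lemma ball_prob_scale n b r c : 0 < b -> 0 < c <= 1 -> r < b ^+ 2 / 4 ->
  ball_prob n b (c ^+ 2 * r) = c ^+ n * ball_prob n b r.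
Proof.
move=> b0 c01 rb; have /andP[c0 c1] := c01.
have c20 : 0 < c ^+ 2 by exact: exprn_gt0.
have cn : 0 < c ^+ n by exact: exprn_gt0.
suff <- : ball_prob n b (c ^+ 2 * r) / c ^+ n = ball_prob n b r.
  by rewrite [RHS]mulrC divfK// gt_eqF.
apply: EFin_inj; rewrite EFinM -(ball_probE n b (c ^+ 2 * r)).
rewrite -(integral_ball_prob_scale n b r c01).
set D := [set u | _].
have mD : measurable D.
  by apply: measurable_setb; apply: measurable_sqnorm_le; exact: measurable_smul.
rewrite -[X in (unif_vec n X * _)%E]setIT -integral_indic// muleC -ge0_integralZl//; last 2 first.
- by apply/measurable_EFinP; exact: measurable_indic.
- by rewrite lee_fin invr_ge0 ltW.
apply: eq_integral => x _; rewrite muleC indicE.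
have [xD|_] := boolP (x \in D); last by rewrite !mul0e.
rewrite !mul1e -exprVn -[X in (_ ^+ X)%:E = _](card_ord n) -prodr_const.
congr (_%:E); apply: eq_bigr => i _.
suff -> : - (c / 2) <= tnth x i < c / 2 by rewrite mulr1.
move: xD; rewrite inE /D /= => xD.
have xi : (b * tnth x i) ^+ 2 < c ^+ 2 * (b ^+ 2 / 4).
  apply: (@le_lt_trans _ _ (c ^+ 2 * r)); last by rewrite ltr_pM2l.
  apply: le_trans xD; rewrite /sqnorm (bigD1 i)//= tnth_mktuple lerDl.
  by apply: sumr_ge0 => j _; exact: sqr_ge0.
have {}xi : tnth x i ^+ 2 < (c / 2) ^+ 2.
  rewrite -(ltr_pM2l (exprn_gt0 2 b0)) -exprMn (lt_le_trans xi)// le_eqVlt.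
  by apply/orP; left; apply/eqP; field.
have c20' : 0 < c / 2 by exact: divr_gt0.
by apply/andP; split; nra.
Qed.

Lemma ball_prob_full n b r : 0 < b -> n%:R * (b ^+ 2 / 4) <= r ->
  ball_prob n b r = 1.
Proof.
move=> b0 nr; apply: EFin_inj; rewrite -(unif_vec_tmod b r [tuple 0 | i < n]).
rewrite (_ : [set u | _] = setT) ?probability_setT//.
apply/seteqP; split => // u _ /=; apply: le_trans nr.
rewrite -[X in X%:R * _](card_ord n) mulr_natl -sumr_const.
apply: ler_sum => i _; rewrite tnth_mktuple.
have /andP[w1 w2] := cfrac_itv (tnth u i - tnth [tuple 0 | _ < n] i / b).
rewrite exprMn ler_pM2l ?exprn_gt0//; nra.
Qed.

(** The ball of squared radius [s] contains the whole cube and has probability one; contracting it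
    gives the ball of squared radius [r]. *)
Lemma ball_prob_gt0 n b r : 0 < b -> 0 < r -> 0 < ball_prob n b r.
Proof.
move=> b0 r0; pose s := n%:R * (b ^+ 2 / 4) + r.
have s0 : 0 < s by rewrite ltr_wpDl// mulr_ge0// divr_ge0 ?sqr_ge0.
have s1 : n%:R * (b ^+ 2 / 4) <= s by rewrite lerDl ltW.
pose c := Num.sqrt (r / s).
have rs0 : 0 < r / s by exact: divr_gt0.
have c0 : 0 < c by rewrite sqrtr_gt0.
have c1 : c <= 1.
  rewrite -sqrtr1 ler_wsqrtr// ler_pdivrMr// mul1r lerDr mulr_ge0//.
  by rewrite divr_ge0 ?sqr_ge0.
have c01 : 0 < c <= 1 by rewrite c0.
have := ball_prob_scale_le n b s c01.
rewrite ball_prob_full// mulr1 sqr_sqrtr ?(ltW rs0)// divfK ?gt_eqF//.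
by apply: lt_le_trans; exact: exprn_gt0.
Qed.

End torus.

(** * Random codes on the torus *)

Section costa_code.
Context {R : realType}.

(** The first suitable codeword wins. The default [vzero] keeps the encoder within its power for
    every draw of the codebook. *)
Definition select n M (b r : R) (U : M.-tuple (n.-tuple R)) (a : n.-tuple R) :
    n.-tuple R :=
  foldr (fun l x => if sqnorm (tmod b (tnth U l) a) <= r
                    then tmod b (tnth U l) a else x) (vzero n) (enum 'I_M).

Definition matches n M (b r : R) (U : M.-tuple (n.-tuple R)) (a : n.-tuple R) :
    bool :=
  has (fun l => sqnorm (tmod b (tnth U l) a) <= r) (enum 'I_M).

(** Ties go to the first match; the analysis counts every second match as an error. *)
Definition decode n M K (b r : R) (w : K.-tuple (M.-tuple (n.-tuple R)))
    (a : n.-tuple R) : option 'I_K :=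
  foldr (fun m o => if matches b r (tnth w m) a then Some m else o)
    None (enum 'I_K).

Lemma selectP n M b r (U : M.-tuple (n.-tuple R)) a :
  (exists2 l, sqnorm (tmod b (tnth U l) a) <= r &
     select b r U a = tmod b (tnth U l) a) \/
  ((forall l, r < sqnorm (tmod b (tnth U l) a)) /\ select b r U a = vzero n).
Proof.
suff H s : (exists2 l, sqnorm (tmod b (tnth U l) a) <= r &
     foldr (fun l x => if sqnorm (tmod b (tnth U l) a) <= r
                    then tmod b (tnth U l) a else x) (vzero n) s =
     tmod b (tnth U l) a) \/
   ((forall l, l \in s -> r < sqnorm (tmod b (tnth U l) a)) /\
     foldr (fun l x => if sqnorm (tmod b (tnth U l) a) <= r
                    then tmod b (tnth U l) a else x) (vzero n) s = vzero n).
  have [H1|[H1 H2]] := H (enum 'I_M); first by left.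
  by right; split => // l; apply: H1; rewrite mem_enum.
elim: s => [|l s IHs] /=; first by right.
have [lr|lr] := leP (sqnorm (tmod b (tnth U l) a)) r; first by left; exists l.
have [|[H1 H2]] := IHs; first by left.
by right; split => // l'; rewrite inE => /orP[/eqP ->//|]; exact: H1.
Qed.

Lemma matchesP n M b r (U : M.-tuple (n.-tuple R)) a :
  reflect (exists l, sqnorm (tmod b (tnth U l) a) <= r) (matches b r U a).
Proof.
apply: (iffP hasP) => [[l _ lr]|[l lr]]; first by exists l.
by exists l => //; rewrite mem_enum.
Qed.

Lemma decodeE n M K b r (w : K.-tuple (M.-tuple (n.-tuple R))) a m :
  matches b r (tnth w m) a ->
  (forall m', m' != m -> ~~ matches b r (tnth w m') a) ->
  decode b r w a = Some m.
Proof.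
move=> wm wm'; rewrite /decode.
have : m \in enum 'I_K by rewrite mem_enum.
elim: (enum 'I_K) => //= m' s IHs; rewrite inE.
have [<- _|m'm] := eqVneq m m'; first by rewrite wm.
by rewrite (negbTE (wm' m' _)) 1?eq_sym.
Qed.

Lemma measurable_select d (T : measurableType d) n M b r
    (f : T -> M.-tuple (n.-tuple R)) (g : T -> n.-tuple R) :
  measurable_fun [set: T] f -> measurable_fun [set: T] g ->
  measurable_fun [set: T] (fun x => select b r (f x) (g x)).
Proof.
move=> mf mg; rewrite /select; elim: (enum 'I_M) => [|l s IHs] /=.
  exact: measurable_cst.
have ml : measurable_fun [set: T] (fun x => tmod b (tnth (f x) l) (g x)).
  apply: measurable_tmod => //.
  exact: (measurableT_comp (@measurable_tnth _ (n.-tuple R) M l) mf).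
by apply: measurable_fun_ifT => //; exact: measurable_sqnorm_le.
Qed.

Lemma measurable_matches d (T : measurableType d) n M b r
    (f : T -> M.-tuple (n.-tuple R)) (g : T -> n.-tuple R) :
  measurable_fun [set: T] f -> measurable_fun [set: T] g ->
  measurable_fun [set: T] (fun x => matches b r (f x) (g x)).
Proof.
move=> mf mg; rewrite /matches; elim: (enum 'I_M) => [|l s IHs] /=.
  exact: measurable_cst.
have ml : measurable_fun [set: T] (fun x => tmod b (tnth (f x) l) (g x)).
  apply: measurable_tmod => //.
  exact: (measurableT_comp (@measurable_tnth _ (n.-tuple R) M l) mf).
by apply: measurable_or => //; exact: measurable_sqnorm_le.
Qed.

Lemma measurable_decode d (T : measurableType d) n M K b r
    (f : T -> K.-tuple (M.-tuple (n.-tuple R))) (g : T -> n.-tuple R) o :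
  measurable_fun [set: T] f -> measurable_fun [set: T] g ->
  measurable [set x | decode b r (f x) (g x) = o].
Proof.
move=> mf mg; rewrite /decode; elim: (enum 'I_K) => [|m s IHs] /=.
  have [->|no] := pselect (o = None).
    by rewrite (_ : [set x | _] = setT)//; apply/seteqP; split.
  by rewrite (_ : [set x | _] = set0)//; apply/seteqP; split => // x /= /esym.
have mm : measurable [set x | matches b r (tnth (f x) m) (g x)].
  apply: measurable_setb; apply: measurable_matches => //.
  exact: (measurableT_comp (@measurable_tnth _ (M.-tuple (n.-tuple R)) K m) mf).
set A := [set x | matches _ _ _ _] in mm.
set B := (X in measurable X) in IHs.
rewrite (_ : [set x | _] = (A `&` [set x | Some m = o]) `|` (~` A `&` B)).
  apply: measurableU; last by apply: measurableI => //; exact: measurableC.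
  apply: measurableI => //.
  have [mo|nmo] := pselect (Some m = o).
    by rewrite (_ : [set x | _] = setT)//; apply/seteqP; split.
  by rewrite (_ : [set x | _] = set0)//; apply/seteqP; split.
apply/seteqP; split => x /=; rewrite /A /B /=.
  by case: ifP => _ H; [left|right].
by case: ifP => _ [[]|[]].
Qed.

End costa_code.

Section costa_rand_code.
Context {R : realType}.
Variables (n M K : nat) (b al P eta : R).
Hypothesis P0 : 0 <= P.

Let cspace := K.-tuple (M.-tuple (n.-tuple R)).

Let cenc (w : cspace) (m : 'I_K) (s : n.-tuple R) : n.-tuple R :=
  select b (n%:R * P) (tnth w m) (smul al s).

Let cdec (w : cspace) (y : n.-tuple R) : option 'I_K :=
  decode b (n%:R * eta) w (smul al y).

Let measurable_cenc2 m :
  measurable_fun [set: cspace * n.-tuple R] (fun ws => cenc ws.1 m ws.2).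
Proof.
apply: measurable_select; last exact: measurable_smul.
exact: (measurableT_comp (@measurable_tnth _ (M.-tuple (n.-tuple R)) K m)).
Qed.

Let measurable_cdec2 o :
  measurable [set wy : cspace * n.-tuple R | cdec wy.1 wy.2 = o].
Proof. by apply: measurable_decode => //; exact: measurable_smul. Qed.

Let measurable_cenc w m : measurable_fun [set: n.-tuple R] (cenc w m).
Proof. by apply: measurable_select => //; exact: measurable_smul. Qed.

Let measurable_cdec w o : measurable [set y | cdec w y = o].
Proof.
apply: (@measurable_decode _ _ _ _ _ _ _ _ (cst w)) => //.
exact: measurable_smul.
Qed.

Let cenc_power w m s : sqnorm (cenc w m s) <= n%:R * P.
Proof.
rewrite /cenc; case: (selectP b (n%:R * P) (tnth w m) (smul al s)).
  by move=> [l lP ->].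
by move=> [_ ->]; rewrite sqnorm0 mulr_ge0.
Qed.

Definition costa_det (w : cspace) : det_code n K P :=
  DetCode (measurable_cenc w) (measurable_cdec w) (cenc_power w).

(** The shared randomness is the draw of the codebooks themselves: [M] independent uniform points
    for each of [K] messages. *)
Definition costa_code : rand_code n K P :=
  @RandCode R n K P _ cspace (iid_prob (iid_prob (unif_vec n) M) K) costa_det
    measurable_cenc2 measurable_cdec2.

End costa_rand_code.

(** * Geometry of the received word and probabilities of the error events *)

Section costa_error.
Context {R : realType}.

(** The two vectors agree modulo the lattice; it is an inequality because reduction may shorten. *)
Lemma tmod_received n b al (u s v : n.-tuple R) : 0 < b ->
  sqnorm (tmod b u (smul al (vadd (vadd (tmod b u (smul al s)) s) v))) <=
  sqnorm (vadd (smul (1 - al) (tmod b u (smul al s))) (smul (- al) v)).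
Proof.
move=> b0; apply: ler_sum => i _; rewrite !tnth_mktuple.
have [z] := cfracE (tnth u i - al * tnth s i / b).
set f := cfrac _ => uE.
have {}uE : tnth u i = f + z%:~R + al * tnth s i / b by rewrite -uE subrK.
have -> : cfrac (tnth u i - al * (b * f + tnth s i + tnth v i) / b) =
    cfrac ((1 - al) * f - al * tnth v i / b).
  rewrite -[RHS](cfracDz _ z); congr cfrac; rewrite uE; field.
  by rewrite gt_eqF.
apply: (@le_trans _ _ (b ^+ 2 * ((1 - al) * f - al * tnth v i / b) ^+ 2)).
  by rewrite exprMn ler_pM2l ?exprn_gt0// cfrac_sqr_le.
rewrite -exprMn le_eqVlt; apply/orP; left; apply/eqP; congr (_ ^+ 2).
by field; rewrite gt_eqF.
Qed.

Definition dot n (x y : n.-tuple R) : R := \sum_(i < n) tnth x i * tnth y i.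

Lemma sqnorm_lin n (c e : R) (x y : n.-tuple R) :
  sqnorm (vadd (smul c x) (smul e y)) =
  c ^+ 2 * sqnorm x + 2 * c * e * dot x y + e ^+ 2 * sqnorm y.
Proof.
rewrite /sqnorm /dot !mulr_sumr -!big_split /=; apply: eq_bigr => i _.
by rewrite !tnth_mktuple; ring.
Qed.

Lemma smul1 n (x : n.-tuple R) : smul 1 x = x.
Proof. by apply: eq_from_tnth => i; rewrite tnth_mktuple mul1r. Qed.

(* A point [x] of the ball whose noise component is too long lies in a cap of
   the ball, hence in a smaller ball with another center. *)
Lemma cap_sub_ball n (al P N eta del : R) (x v : n.-tuple R) :
  0 < al < 1 -> 0 < N -> 0 < del ->
  (1 - al) ^+ 2 * P + al ^+ 2 * N + 2 * al * (1 - al) * del <= eta ->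
  sqnorm x <= n%:R * P -> sqnorm v <= n%:R * N ->
  n%:R * eta < sqnorm (vadd (smul (1 - al) x) (smul (- al) v)) ->
  sqnorm (vadd x (smul (del / N) v)) <= n%:R * (P - del ^+ 2 / N).
Proof.
move=> /andP[al0 al1] N0 d0 etaE xP vN; rewrite sqnorm_lin => H.
rewrite -[x in vadd x _]smul1 sqnorm_lin.
set D := dot x v in H *.
have n0 : 0 <= n%:R :> R by exact: ler0n.
have nE := ler_wpM2l n0 etaE.
have h1 : (1 - al) ^+ 2 * sqnorm x <= (1 - al) ^+ 2 * (n%:R * P).
  by rewrite ler_wpM2l// sqr_ge0.
have h2 : al ^+ 2 * sqnorm v <= al ^+ 2 * (n%:R * N).
  by rewrite ler_wpM2l// sqr_ge0.
(* The norms of [x] and [v] use up all of [eta] except the term in [del], which forces the inner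
   product below [- n * del]. *)
have h3 : 2 * al * (1 - al) * (n%:R * del + D) < 0 by lra.
have c0 : 0 < 2 * al * (1 - al) by rewrite !mulr_gt0// subr_gt0.
have {h3} h3 : n%:R * del + D < 0 by move: h3; rewrite pmulr_rlt0.
(* The factor [del / N] minimises [t^2 N - 2 t del], the change in squared norm per coordinate when
   [t v] is added to [x]. *)
have t0 : 0 < del / N by exact: divr_gt0.
have h4 : (del / N) * (n%:R * del + D) <= 0 by rewrite pmulr_rle0// ltW.
have h5 : (del / N) ^+ 2 * sqnorm v <= (del / N) ^+ 2 * (n%:R * N).
  by rewrite ler_wpM2l// sqr_ge0.
have h6 : (del / N) ^+ 2 * (n%:R * N) = n%:R * (del ^+ 2 / N).
  by field; rewrite gt_eqF.
have h7 : del / N * (n%:R * del) = n%:R * (del ^+ 2 / N).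
  by field; rewrite gt_eqF.
rewrite h6 in h5; rewrite mulrDr h7 in h4.
move: h4 h5; set A := n%:R * (del ^+ 2 / N); set B := (del / N) ^+ 2 * _.
set E := del / N * D => h4 h5.
have -> : 2 * 1 * (del / N) * D = 2 * E by rewrite /E; ring.
by rewrite mulrBr -/A expr1n mul1r; lra.
Qed.

Lemma measure_exists_le d (T : measurableType d) (mu : probability T R)
    (I : finType) (A : I -> set T) (c : R) :
  (forall i, measurable (A i)) -> (forall i, (mu (A i) <= c%:E)%E) ->
  (mu [set x | exists i, A i x] <= (#|I|%:R * c)%:E)%E.
Proof.
move=> mA Ac.
suff H s : measurable [set x | exists2 i, i \in s & A i x] /\
    (mu [set x | exists2 i, i \in s & A i x] <= ((size s)%:R * c)%:E)%E.
  have [_] := H (enum I); rewrite -cardE; apply: le_trans.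
  rewrite le_eqVlt; apply/orP; left; apply/eqP; congr (mu _).
  apply/seteqP; split => x /= [i]; first by exists i; rewrite ?mem_enum.
  by move=> _ ix; exists i.
elim: s => [|i s [IHm IHs]].
  rewrite (_ : [set x | _] = set0); last by apply/seteqP; split => // x [].
  by rewrite measure0 mul0r.
have -> : [set x | exists2 j, j \in i :: s & A j x] =
    A i `|` [set x | exists2 j, j \in s & A j x].
  apply/seteqP; split => x /=.
    by move=> [j]; rewrite inE => /orP[/eqP ->|js] jx; [left|right; exists j].
  by move=> [ix|[j js jx]]; [exists i|exists j]; rewrite ?mem_head// inE js orbT.
split; first exact: measurableU.
apply: (le_trans (measureU2 mu (mA i) IHm)).
apply: (le_trans (leeD (Ac i) IHs)).
by rewrite -EFinD lee_fin /= -(addn1 (size s)) natrD mulrDl mul1r addrC.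
Qed.

Lemma measurable_tmod_le n b r (a : n.-tuple R) :
  measurable [set u : n.-tuple R | sqnorm (tmod b u a) <= r].
Proof.
by apply: measurable_setb; apply: measurable_sqnorm_le; exact: measurable_tmod.
Qed.

Lemma measurable_matches_set n M b r (a : n.-tuple R) :
  measurable [set U : M.-tuple (n.-tuple R) | matches b r U a].
Proof. by apply: measurable_setb; exact: measurable_matches. Qed.

Lemma matches_prob n M b r (a : n.-tuple R) :
  (iid_prob (unif_vec n) M [set U | matches b r U a] <=
   (M%:R * ball_prob n b r)%:E)%E.
Proof.
rewrite -[X in X%:R](card_ord M).
rewrite (_ : [set U | _] = [set U | exists l : 'I_M,
    [set U : M.-tuple (n.-tuple R) | [set u | sqnorm (tmod b u a) <= r] (tnth U l)] U]); last first.
  by apply/seteqP; split => U /= /matchesP.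
have mA := measurable_tmod_le b r a.
apply: measure_exists_le => l.
  rewrite -[X in measurable X]setTI.
  exact: (@measurable_tnth _ (n.-tuple R) M l).
by rewrite iid_prob_tnth// unif_vec_tmod.
Qed.

Notation code_law n M K := (iid_prob (iid_prob (unif_vec n) M) K).

Lemma no_codeword_prob n M K b r (m : 'I_K) (a : n.-tuple R) :
  code_law n M K [set w | forall l, r < sqnorm (tmod b (tnth (tnth w m) l) a)] =
  ((1 - ball_prob n b r) ^+ M)%:E.
Proof.
have mA : measurable [set u : n.-tuple R | r < sqnorm (tmod b u a)].
  rewrite (_ : [set u | _] = ~` [set u | sqnorm (tmod b u a) <= r]).
    exact: measurableC (measurable_tmod_le b r a).
  by apply/seteqP; split => u /=; rewrite real_ltNge ?num_real// => /negP.
pose B := [set U : M.-tuple (n.-tuple R) |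
  forall l, [set u | r < sqnorm (tmod b u a)] (tnth U l)].
have mB : measurable B.
  rewrite (_ : B = ~` [set U | matches b r U a]).
    exact: measurableC (measurable_matches_set b r a).
  apply/seteqP; split => U /=.
    by move=> BU /matchesP[l]; rewrite leNgt BU.
  move=> nU l /=; rewrite ltNge; apply/negP => lr; apply: nU.
  by apply/matchesP; exists l.
rewrite -[LHS]/(code_law n M K [set w | B (tnth w m)]) iid_prob_tnth//.
rewrite /B (@iid_probE _ _ _ _ _ (fun=> [set u | r < sqnorm (tmod b u a)]))//.
have -> : unif_vec n [set u | r < sqnorm (tmod b u a)] =
    (1 - ball_prob n b r)%:E.
  rewrite EFinB -(unif_vec_tmod b r a) -probability_setC; last first.
    exact: measurable_tmod_le.
  congr (unif_vec n _); apply/seteqP; split => u /=;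
    by rewrite real_ltNge ?num_real// => /negP.
by rewrite prodEFin prodr_const card_ord.
Qed.

Lemma some_codeword_prob n M K b r (m : 'I_K) (a : n.-tuple R) :
  (code_law n M K [set w | matches b r (tnth w m) a] <=
   (M%:R * ball_prob n b r)%:E)%E.
Proof.
rewrite -[X in (X <= _)%E]/(code_law n M K [set w | [set U | matches b r U a] (tnth w m)]).
by rewrite iid_prob_tnth ?matches_prob//; exact: measurable_matches_set.
Qed.

(** The received word depends only on the codebook of [m], so resampling the codebook of [m'] leaves
    it fixed, and the union bound for a fixed centre applies. *)
Lemma false_alarm_prob n M K b r (m m' : 'I_K)
    (Y : M.-tuple (n.-tuple R) -> n.-tuple R) :
  measurable_fun [set: M.-tuple (n.-tuple R)] Y -> m' != m ->
  (code_law n M K [set w | matches b r (tnth w m') (Y (tnth w m))] <=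
   (M%:R * ball_prob n b r)%:E)%E.
Proof.
move=> mY mm'; set A := [set w | _].
have mt (i : 'I_K) : measurable_fun [set: K.-tuple (M.-tuple (n.-tuple R))]
    (@tnth K (M.-tuple (n.-tuple R)) ^~ i) by exact: measurable_tnth.
have mA : measurable A.
  apply: measurable_setb; apply: measurable_matches => //.
  exact: (measurableT_comp mY (mt m)).
have mI : measurable_fun [set: K.-tuple (M.-tuple (n.-tuple R))]
    (fun w => (\1_A w : R)%:E).
  by apply/measurable_EFinP; exact: measurable_indic.
rewrite -[A]setIT -integral_indic// (integral_iid_resample _ m')//.
apply: (@le_trans _ _ (\int[code_law n M K]_w (M%:R * ball_prob n b r)%:E)%E); last first.
  by rewrite integral_cst//= probability_setT mule1.
have p0 : 0 <= M%:R * ball_prob n b r by rewrite mulr_ge0// ball_prob_ge0.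
apply: ge0_le_integral => //.
- by move=> w _; apply: integral_ge0 => u _; rewrite lee_fin.
- apply: (measurable_fun_fubini_tonelli_F
    (fun wu : K.-tuple (M.-tuple (n.-tuple R)) * M.-tuple (n.-tuple R) =>
      (\1_A (tupd wu.1 m' wu.2) : R)%:E)) => //.
  by apply: (measurableT_comp mI); exact: measurable_tupd.
- move=> w _; apply: le_trans (matches_prob M b r (Y (tnth w m))).
  rewrite -[X in (_ <= iid_prob _ _ X)%E]setIT -integral_indic//; last first.
    exact: measurable_matches_set.
  rewrite le_eqVlt; apply/orP; left; apply/eqP; apply: eq_integral => u _.
  rewrite !indicE; congr (_%:R%:E); congr nat_of_bool.
  apply/idP/idP; rewrite !inE /A /= !tnth_tupd eqxx;
    by rewrite eq_sym (negbTE mm').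
Qed.

End costa_error.

(** * Achievability *)

Section kernel_reindex.
Context d1 d2 d3 (X : measurableType d1) (Y : measurableType d2)
  (Z : measurableType d3) (R : realType).
Variables (Q : R.-pker X ~> Y) (f : Z -> X).

(* The argument [mf] only serves to let unification find the kernel instance. *)
Definition kreindex (mf : measurable_fun [set: Z] f) (z : Z) :
  {measure set Y -> \bar R} := Q (f z).

Hypothesis mf : measurable_fun [set: Z] f.

Let measurable_kreindex U : measurable U ->
  measurable_fun [set: Z] (kreindex mf ^~ U).
Proof.
by move=> mU; apply: (measurableT_comp (measurable_kernel Q U mU) mf).
Qed.

HB.instance Definition _ := isKernel.Build _ _ _ _ _ (kreindex mf)
  measurable_kreindex.

Let kreindex_prob z : kreindex mf z [set: Y] = 1%E.
Proof. exact: prob_kernel. Qed.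

HB.instance Definition _ := Kernel_isProbability.Build _ _ _ _ _
  (kreindex mf) kreindex_prob.

End kernel_reindex.

Section kprob.
Context d1 d2 (X : measurableType d1) (Y : measurableType d2) (R : realType).
Variables (Q : R.-pker X ~> Y) (x : X).
(** Gives [Q x] a probability structure of its own, for exchanging the integrals over code and
    jamming vector. *)
Definition kernel_prob : set Y -> \bar R := Q x.
HB.instance Definition _ := Measure.on kernel_prob.
Let kernel_probT : kernel_prob [set: Y] = 1%E.
Proof. exact: prob_kernel. Qed.
HB.instance Definition _ := Measure_isProbability.Build _ _ R kernel_prob kernel_probT.
End kprob.

Section error_upper_bound.
Context {R : realType}.
Local Open Scope ereal_scope.

Lemma det_error_le1 n K (P sigma : R) (c : det_code n K P) m s j :
  det_error sigma c m s j <= 1.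
Proof. by apply: probability_le1; exact: measurable_det_error_set. Qed.

Lemma integral_le_cst d (T : measurableType d) (mu : probability T R)
    (f : T -> \bar R) (c : R) : measurable_fun [set: T] f ->
  (forall x, 0 <= f x) -> (forall x, f x <= c%:E) -> \int[mu]_x f x <= c%:E.
Proof.
move=> mf f0 fc.
have -> : c%:E = \int[mu]_x c%:E.
  by rewrite integral_cst//= probability_setT mule1.
by apply: ge0_le_integral.
Qed.

Lemma integral_le_split d (T : measurableType d) (mu : probability T R)
    (f : T -> \bar R) (B : set T) (c : R) : (0 <= c)%R -> measurable B ->
  measurable_fun [set: T] f ->
  (forall x, 0 <= f x) -> (forall x, f x <= 1) ->
  (forall x, ~ B x -> f x <= c%:E) ->
  \int[mu]_x f x <= c%:E + mu B.
Proof.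
move=> c0 mB mf f0 f1 fc.
have mI : measurable_fun [set: T] (fun x => (\1_B x : R)%:E).
  by apply/measurable_EFinP; exact: measurable_indic.
apply: (@le_trans _ _ (\int[mu]_x (c%:E + (\1_B x)%:E))).
  apply: ge0_le_integral => //.
  - exact: emeasurable_funD.
  - move=> x _; rewrite indicE; have [xB|xB] := boolP (x \in B).
      by apply: (le_trans (f1 x)); rewrite leeDr// lee_fin.
    by rewrite adde0; apply: fc => /mem_set; rewrite (negbTE xB).
rewrite ge0_integralD//.
by rewrite integral_cst//= probability_setT mule1 integral_indic// setIT.
Qed.

Lemma measurable_decode_error n K (P : R) (Theta : rand_code n K P) m s j :
  measurable [set wz : rc_space Theta * n.-tuple R |
    dec (rc_code Theta wz.1) (vadd (vadd (vadd
      (enc (rc_code Theta wz.1) m s) s) j) wz.2) <> Some m].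
Proof.
pose f (wz : rc_space Theta * n.-tuple R) := (wz.1, vadd (vadd (vadd
      (enc (rc_code Theta wz.1) m s) s) j) wz.2).
have mf : measurable_fun [set: rc_space Theta * n.-tuple R] f.
  apply/measurable_fun_pairP; split; first exact: measurable_fst.
  rewrite /f /comp /=; apply: measurable_vadd => //; apply: measurable_vadd => //.
  apply: measurable_vadd => //.
  have ms : measurable_fun [set: rc_space Theta * n.-tuple R]
      (fun wz : rc_space Theta * n.-tuple R => (wz.1, s)).
    by apply/measurable_fun_pairP; split; [exact: measurable_fst|exact: measurable_cst].
  exact: (measurableT_comp (measurable_rc_enc (r := Theta) m) ms).
have mD := measurable_rc_dec (r := Theta) (Some m).
by have := measurableC (mf measurableT _ mD); rewrite setTI.
Qed.

(** With the code integrated innermost, what remains for fixed [s], [j] and [z] is a probability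
    over the code alone, the setting of the random coding argument. *)
Lemma integral_det_error_swap n K (P sigma : R) (Theta : rand_code n K P) m s j :
  \int[rc_law Theta]_w det_error sigma (rc_code Theta w) m s j =
  \int[gauss_vec n sigma]_z rc_law Theta [set w |
    dec (rc_code Theta w) (vadd (vadd (vadd
      (enc (rc_code Theta w) m s) s) j) z) <> Some m].
Proof.
set A := fun w z => dec (rc_code Theta w) (vadd (vadd (vadd
      (enc (rc_code Theta w) m s) s) j) z) <> Some m.
have mA : measurable [set wz | A wz.1 wz.2] by exact: measurable_decode_error.
have mI : measurable_fun [set: rc_space Theta * n.-tuple R]
    (fun wz => (\1_[set wz | A wz.1 wz.2] wz : R)%:E).
  by apply/measurable_EFinP; exact: measurable_indic.
have I0 (wz : rc_space Theta * n.-tuple R) :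
    0 <= (\1_[set wz | A wz.1 wz.2] wz : R)%:E by rewrite lee_fin.
have := fubini_tonelli (m1 := rc_law Theta) (m2 := gauss_vec n sigma) _ mI I0.
have inE1 w : \int[gauss_vec n sigma]_z (\1_[set wz | A wz.1 wz.2] (w, z))%:E =
    det_error sigma (rc_code Theta w) m s j.
  rewrite /det_error -[X in _ = gauss_vec n sigma X]setIT -integral_indic//.
  exact: measurable_det_error_set.
have inE2 z : \int[rc_law Theta]_w (\1_[set wz | A wz.1 wz.2] (w, z))%:E =
    rc_law Theta [set w | A w z].
  rewrite -[X in _ = rc_law Theta X]setIT -integral_indic//.
  rewrite -[X in measurable X]setTI.
  exact: (measurable_pair2 z measurableT mA).
under eq_integral do rewrite inE1.
by under [in RHS]eq_integral do rewrite inE2.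
Qed.

(** The jammer's kernel does not see the code, so the code integral moves past those over [s], [j]
    and [z]. A bound uniform in these vectors therefore covers any dependence of [j] on [s]. Jamming
    vectors outside the ball have mass zero, and overlong [j + z] cost [rho]. *)
Lemma error_prob_le n K (P L N sigma sigmaS D rho : R) (Theta : rand_code n K P)
    (m : 'I_K) (Q : R.-pker n.-tuple R ~> n.-tuple R) :
  (0 <= D)%R -> (0 <= rho)%R ->
  (forall s, Q s (power_ball L) = 1) ->
  (forall j : n.-tuple R, (sqnorm j <= n%:R * L)%R ->
     gauss_vec n sigma [set z | (n%:R * N < sqnorm (vadd j z))%R] <= rho%:E) ->
  (forall s j z, (sqnorm (vadd j z) <= n%:R * N)%R ->
     rc_law Theta [set w | dec (rc_code Theta w) (vadd (vadd (vadd
      (enc (rc_code Theta w) m s) s) j) z) <> Some m] <= D%:E) ->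
  error_prob sigma sigmaS Theta m Q <= (D + rho)%:E.
Proof.
move=> D0 rho0 Q1 Hrho HD.
have DR : (0 <= D + rho)%R by exact: addr_ge0.
rewrite error_probE.
have mH := @measurable_det_error R n K P sigma Theta m.
pose H (u : (rc_space Theta * n.-tuple R) * n.-tuple R) :=
  det_error sigma (rc_code Theta u.1.1) m u.1.2 u.2.
have H0 u : 0 <= H u by exact: det_error_ge0.
pose G (ws : rc_space Theta * n.-tuple R) := \int[Q ws.2]_j H (ws, j).
have mG : measurable_fun [set: rc_space Theta * n.-tuple R] G.
  have m2 : measurable_fun [set: rc_space Theta * n.-tuple R]
    (snd : rc_space Theta * n.-tuple R -> n.-tuple R) by exact: measurable_snd.
  exact: (measurable_fun_integral_finite_kernel H (kreindex Q m2) H0 mH).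
have G0 ws : 0 <= G ws by apply: integral_ge0.
rewrite -[X in X <= _]/(\int[rc_law Theta]_w \int[gauss_vec n sigmaS]_s G (w, s)).
rewrite (fubini_tonelli G mG G0).
apply: integral_le_cst.
- exact: measurable_fun_fubini_tonelli_G.
- by move=> s; apply: integral_ge0.
move=> s.
have mHs : measurable_fun [set: rc_space Theta * n.-tuple R]
    (fun wj => H ((wj.1, s), wj.2)).
  have ms : measurable_fun [set: rc_space Theta * n.-tuple R]
      (fun wj : rc_space Theta * n.-tuple R => (wj.1, s)).
    by apply/measurable_fun_pairP; split; [exact: measurable_fst|exact: measurable_cst].
  have msj : measurable_fun [set: rc_space Theta * n.-tuple R]
      (fun wj : rc_space Theta * n.-tuple R => ((wj.1, s), wj.2)).
    by apply/measurable_fun_pairP; split; [exact: ms|exact: measurable_snd].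
  exact: (measurableT_comp mH msj).
rewrite -[X in X <= _]/(\int[rc_law Theta]_w \int[kernel_prob Q s]_j H ((w, s), j)).
rewrite (fubini_tonelli (fun wj : rc_space Theta * n.-tuple R => H ((wj.1, s), wj.2)) mHs (fun wj => H0 _)).
have mB : measurable (@power_ball R n L).
  by apply: measurable_setb; exact: measurable_sqnorm_le.
apply: (@le_trans _ _ ((D + rho)%:E + kernel_prob Q s (~` power_ball L))).
  apply: integral_le_split => //.
  - exact: measurableC.
  - exact: (measurable_fun_fubini_tonelli_G _ mHs).
  - by move=> j; apply: integral_ge0.
  - move=> j; apply: integral_le_cst => //.
      by apply: (measurableT_comp mHs (measurable_pair2 j)).
    by move=> w; exact: det_error_le1.
  move=> j /contrapT jL.
  rewrite [X in X <= _]integral_det_error_swap.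
  apply: (@le_trans _ _ (D%:E + gauss_vec n sigma [set z | (n%:R * N < sqnorm (vadd j z))%R])); last first.
    by rewrite EFinD leeD2l// Hrho.
  have mA := measurable_decode_error (Theta := Theta) m s j.
  have mAz z : measurable [set w | dec (rc_code Theta w) (vadd (vadd (vadd
      (enc (rc_code Theta w) m s) s) j) z) <> Some m].
    have := measurable_ysection z mA.
    set A := ysection _ _; set B := [set w | _]; rewrite (_ : A = B)//.
    by apply/seteqP; split => w; rewrite /A /B /ysection /= inE.
  apply: integral_le_split => //.
  - apply: measurable_setb; apply: measurable_fun_ltr => //.
    apply: (measurableT_comp (@measurable_sqnorm R n)).
    exact: measurable_vadd.
  - have := measurable_fun_ysection (rc_law Theta) mA.
    apply: eq_measurable_fun => z _ /=; congr (rc_law Theta _).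
    by apply/seteqP; split => w; rewrite /ysection /= inE.
  - by move=> z; exact: probability_le1.
  - by move=> z /negP; rewrite -leNgt => zN; exact: HD.
have -> : kernel_prob Q s (~` power_ball L) = 0.
  by rewrite probability_setC// [X in 1 - X]Q1 subee.
by rewrite adde0.
Qed.

End error_upper_bound.

Section costa_analysis.
Context {R : realType}.

(** An error forces one of three events: [A0], no codeword of [m] obeys the power constraint; [A1],
    some codeword of [m] falls into the small ball containing the cap; [A2], a codeword of another
    message is accepted. [A1] concerns all codewords of [m], so the dependence of the sent one on
    the codebook does not matter. *)
Lemma costa_error_le n M K (b al P N del eta r : R) (P0 : 0 <= P) (m : 'I_K)
    (s j z : n.-tuple R) :
  0 < b -> 0 < al < 1 -> 0 < N -> 0 < del ->
  (1 - al) ^+ 2 * P + al ^+ 2 * N + 2 * al * (1 - al) * del <= eta ->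
  P - del ^+ 2 / N <= r -> sqnorm (vadd j z) <= n%:R * N ->
  (rc_law (costa_code n M K b al eta P0) [set w |
      dec (costa_det b al eta P0 w) (vadd (vadd (vadd
        (enc (costa_det b al eta P0 w) m s) s) j) z) <> Some m] <=
   ((1 - ball_prob n b (n%:R * P)) ^+ M + M%:R * ball_prob n b (n%:R * r) +
    K%:R * (M%:R * ball_prob n b (n%:R * eta)))%:E)%E.
Proof.
move=> b0 al01 N0 del0 etaE rE vN.
pose Theta := costa_code n M K b al eta P0.
pose x (U : M.-tuple (n.-tuple R)) := select b (n%:R * P) U (smul al s).
pose y U := smul al (vadd (vadd (vadd (x U) s) j) z).
have my : measurable_fun [set: M.-tuple (n.-tuple R)] y.
  apply: measurable_smul; do 3 (apply: measurable_vadd => //).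
  exact: measurable_select.
pose A0 := [set w : K.-tuple (M.-tuple (n.-tuple R)) |
  forall l, n%:R * P < sqnorm (tmod b (tnth (tnth w m) l) (smul al s))].
(* Determined by [s], [j] and [z] alone, so that [A1] is a union over codewords with a fixed
   centre. *)
pose a1 := vadd (smul al s) (smul (-1) (smul (del / N) (vadd j z))).
pose A1 := [set w : K.-tuple (M.-tuple (n.-tuple R)) |
  matches b (n%:R * r) (tnth w m) a1].
pose B (m' : 'I_K) := [set w : K.-tuple (M.-tuple (n.-tuple R)) |
  (m' != m) && matches b (n%:R * eta) (tnth w m') (y (tnth w m))].
pose A2 := [set w | exists m', B m' w].
have mt (i : 'I_K) : measurable_fun [set: K.-tuple (M.-tuple (n.-tuple R))]
    (@tnth K (M.-tuple (n.-tuple R)) ^~ i) by exact: measurable_tnth.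
have mA1 : measurable A1.
  by apply: measurable_setb; apply: measurable_matches.
have mA0 : measurable A0.
  rewrite (_ : A0 = ~` [set w | matches b (n%:R * P) (tnth w m) (smul al s)]).
    by apply: measurableC; apply: measurable_setb; apply: measurable_matches.
  apply/seteqP; split => w; first by move=> w0 /matchesP[l]; rewrite leNgt w0.
  by move=> w0 l; rewrite ltNge; apply/negP => lP; apply: w0; apply/matchesP; exists l.
have mB m' : measurable (B m').
  apply: measurable_setb; apply: measurable_and => //.
  apply: measurable_matches; first exact: mt.
  exact: (measurableT_comp my (mt m)).
have mA2 : measurable A2.
  rewrite (_ : A2 = \bigcup_m' B m'); last first.
    by apply/seteqP; split => w; [move=> [i Bi]; exists i|move=> [i _ Bi]; exists i].
  by apply: fin_bigcup_measurable.
have sub : [set w | dec (rc_code Theta w) (vadd (vadd (vadd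
      (enc (rc_code Theta w) m s) s) j) z) <> Some m] `<=` A0 `|` A1 `|` A2.
  move=> w /=; apply: contra_notP => /not_orP[/not_orP[nA0 nA1] nA2].
  apply: decodeE; last first.
    move=> m' mm'; apply/negP => wm'; apply: nA2; exists m'.
    by rewrite /B /= mm'.
  have [[l lP xE]|[H _]] := selectP b (n%:R * P) (tnth w m) (smul al s); last first.
    by exfalso; exact: nA0.
  apply/matchesP; exists l.
  rewrite xE -vaddA.
  apply: (le_trans (tmod_received _ _ _ _ b0)).
  rewrite leNgt; apply/negP => H; apply: nA1; apply/matchesP; exists l.
  apply: (le_trans (tmod_shift_sqnorm_le _ _ _ b0)).
  apply: (le_trans (cap_sub_ball al01 N0 del0 etaE lP vN H)).
  by rewrite ler_wpM2l.
apply: (le_trans (le_measure _ _ _ sub)).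
- rewrite inE; have := measurable_decode_error (Theta := Theta) m s j.
  move=> /(measurable_ysection z).
  set C := ysection _ _; set D := [set w | _]; rewrite (_ : C = D)//.
  by apply/seteqP; split => w; rewrite /C /D /ysection /= inE.
- by rewrite inE; do 2 (apply: measurableU => //).
have mA01 : measurable (A0 `|` A1) by exact: measurableU.
apply: (le_trans (measureU2 _ mA01 mA2)); rewrite 2!EFinD.
apply: leeD.
  apply: (le_trans (measureU2 _ mA0 mA1)).
  apply: leeD; last exact: some_codeword_prob.
  by rewrite [X in (X <= _)%E]no_codeword_prob.
rewrite -[X in X%:R](card_ord K).
apply: (@measure_exists_le _ _ _ (rc_law Theta) 'I_K B (M%:R * ball_prob n b (n%:R * eta))) => // m'.
have [->|mm'] := eqVneq m' m.
  rewrite (_ : B m = set0) ?measure0 ?lee_fin ?mulr_ge0 ?ball_prob_ge0//.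
  by apply/seteqP; split => w //=; rewrite /B /= eqxx.
rewrite (_ : B m' = [set w | matches b (n%:R * eta) (tnth w m') (y (tnth w m))]).
  exact: false_alarm_prob.
by rewrite /B mm'.
Qed.

End costa_analysis.

Section achievability.
Context {R : realType}.

(** Write [q = x^2]. One factor [x^n] absorbs [n + 1], as [(n + 1) x^n] is at most a geometric sum
    bounded by [1 / (1 - x)]; the other tends to zero. *)
Lemma nat_expr_eventually_le (q d : R) : 0 <= q < 1 -> 0 < d ->
  exists N, forall n, (N <= n)%N -> n.+1%:R * q ^+ n <= d.
Proof.
move=> /andP[q0 q1] d0; pose x := Num.sqrt q.
have x0 : 0 <= x by exact: sqrtr_ge0.
have xE : x ^+ 2 = q by exact: sqr_sqrtr.
have x1 : x < 1 by rewrite -sqrtr1 ltr_sqrt.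
have y0 : 0 < 1 - x by rewrite subr_gt0.
have bound n : n.+1%:R * x ^+ n <= (1 - x)^-1.
  rewrite -[leRHS]mul1r ler_pdivlMr//.
  apply: (@le_trans _ _ (1 - x ^+ n.+1)); last by rewrite gerBl exprn_ge0.
  rewrite -[leRHS]opprB subrX1 -mulNr opprB mulrC ler_wpM2l ?(ltW y0)//.
  rewrite -[n.+1 in leLHS]card_ord -sumr_const mulr_suml.
  apply: ler_sum => i _; rewrite mul1r ler_wiXn2l ?(ltW x1)//.
  by rewrite -ltnS.
have [N HN] := @expr_eventually_le R x ((1 - x) * d) ltac:(by rewrite x0 x1)
  (mulr_gt0 y0 d0).
exists N => n /HN xd; rewrite -xE -exprM mulnC exprM expr2 mulrA.
apply: (@le_trans _ _ ((1 - x)^-1 * ((1 - x) * d))).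
  by rewrite ler_pM ?mulr_ge0 ?exprn_ge0.
by rewrite mulKf ?gt_eqF.
Qed.

(** For a rational rate, [2^(n r)] is an integer whenever [n] is a multiple of the denominator; such
    rates approach the capacity. *)
Lemma ratio_between (x y : R) : 0 <= x < y ->
  exists a b : nat, (0 < b)%N /\ x <= a%:R / b%:R < y.
Proof.
move=> /andP[x0 xy]; pose b := (Num.trunc (y - x)^-1).+1.
have b0 : 0 < b%:R :> R by rewrite ltr0n.
have yx0 : 0 < y - x by rewrite subr_gt0.
have hb : 1 < b%:R * (y - x).
  by rewrite -ltr_pdivrMr// mul1r; exact: truncnS_gt.
exists (Num.trunc (b%:R * x)).+1, b; split => //.
have bx0 : 0 <= b%:R * x by rewrite mulr_ge0.
have := truncn_itv bx0 => /andP[h1 h2].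
rewrite ler_pdivlMr// ltr_pdivrMr// mulrC (ltW h2)/= -natr1.
by lra.
Qed.

(* With about [n / p] codewords per message, [p] being the volume of the ball of
   the power constraint, the unknown volume [p] cancels out of every term. *)
Lemma costa_code_error n (P al N del c1 c2 : R) (P0 : 0 < P) : (0 < n)%N ->
  0 < al < 1 -> 0 < N -> 0 < del -> 0 < c1 <= 1 -> 0 < c2 <= 1 ->
  (1 - al) ^+ 2 * P + al ^+ 2 * N + 2 * al * (1 - al) * del <= c2 ^+ 2 * P ->
  P - del ^+ 2 / N <= c1 ^+ 2 * P ->
  exists M b, forall K (m : 'I_K) (s j z : n.-tuple R),
  sqnorm (vadd j z) <= n%:R * N ->
  (rc_law (costa_code n M K b al (c2 ^+ 2 * P) (ltW P0)) [set w |
      dec (costa_det b al (c2 ^+ 2 * P) (ltW P0) w) (vadd (vadd (vadd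
        (enc (costa_det b al (c2 ^+ 2 * P) (ltW P0) w) m s) s) j) z)
      <> Some m] <=
   (expR (-1) ^+ n + n.+1%:R * c1 ^+ n + K%:R * (n.+1%:R * c2 ^+ n))%:E)%E.
Proof.
move=> n0 al01 N0 del0 c101 c201 h2 h1.
have nP0 : 0 < n%:R * P by rewrite mulr_gt0// ltr0n.
(* The power ball has radius below [b / 2], so that the exact scaling law applies. *)
pose b := 2 * Num.sqrt (n%:R * P) + 1.
have sq0 : 0 <= Num.sqrt (n%:R * P) by exact: sqrtr_ge0.
have b0 : 0 < b by rewrite /b; lra.
have Pb : n%:R * P < b ^+ 2 / 4.
  rewrite -[ltLHS](sqr_sqrtr (ltW nP0)) /b.
  move: sq0; set u := Num.sqrt _ => u0.
  have -> : (2 * u + 1) ^+ 2 / 4 = u ^+ 2 + u + 1 / 4 by field.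
  by lra.
have p0 := ball_prob_gt0 n b0 nP0.
have p1 := ball_prob_le1 n b (n%:R * P).
have Pc c : n%:R * (c ^+ 2 * P) = c ^+ 2 * (n%:R * P) by ring.
have b1 : ball_prob n b (n%:R * (c1 ^+ 2 * P)) =
    c1 ^+ n * ball_prob n b (n%:R * P) by rewrite Pc ball_prob_scale.
have b2 : ball_prob n b (n%:R * (c2 ^+ 2 * P)) =
    c2 ^+ n * ball_prob n b (n%:R * P) by rewrite Pc ball_prob_scale.
set p := ball_prob n b (n%:R * P) in p0 p1 b1 b2.
(* This puts [M * p] between [n] and [n + 1]: the lower bound makes an empty ball as rare as
   [expR (- n)], the upper one costs only a linear factor in the union bounds. *)
pose M := (Num.trunc (n%:R / p)).+1.
have np0 : 0 <= n%:R / p by rewrite divr_ge0// ltW.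
have /andP[M1 M2] := truncn_itv np0.
have Mp_ge : n%:R <= M%:R * p by rewrite -ler_pdivrMr// ltW.
have Mp_le : M%:R * p <= n.+1%:R.
  rewrite /M -natr1 mulrDl mul1r -natr1 lerD//.
  by rewrite -ler_pdivlMr.
exists M, b => K m s j z vN.
apply: (le_trans (costa_error_le M (ltW P0) m s b0 al01 N0 del0 h2 h1 vN)).
rewrite lee_fin -/p b1 b2.
have [c10 _] := andP c101; have [c20 _] := andP c201.
apply: lerD; first apply: lerD.
- rewrite -expRM_natl mulrN1.
  apply: (@le_trans _ _ (expR (- p) ^+ M)).
    by rewrite lerXn2r ?nnegrE ?subr_ge0 ?expR_ge0 ?expR_ge1Dx.
  by rewrite -expRM_natl ler_expR mulrN lerN2.
- by rewrite mulrCA mulrC ler_wpM2r ?exprn_ge0 ?(ltW c10).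
- rewrite ler_wpM2l//.
  by rewrite mulrCA mulrC ler_wpM2r ?exprn_ge0 ?(ltW c20).
Qed.

Lemma achievable_ratio (P L sigma sigmaS : R) (a b : nat) :
  0 < P -> 0 < L -> 0 < sigma -> (0 < b)%N ->
  a%:R / b%:R < 2^-1 * log2 (1 + P / (L + sigma ^+ 2)) ->
  achievable P L sigma sigmaS (a%:R / b%:R).
Proof.
have le4 (n1 n2 n3 n4 n : nat) : (n1 + n2 + n3 + n4 < n)%N ->
    [/\ (n1 <= n)%N, (n2 <= n)%N, (n3 <= n)%N & (n4 <= n)%N]
  by move=> h; split; lia.
move=> P0 L0 s0 b0; set r := a%:R / b%:R; set N := L + sigma ^+ 2 => rC.
have N0 : 0 < N by rewrite addr_gt0// exprn_gt0.
have ln20 : 0 < ln 2 :> R by rewrite ln_gt0// ltr1n.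
have r0 : 0 <= r by rewrite divr_ge0.
pose g := 2 `^ r : R.
have g1 : 1 <= g by rewrite -[leLHS](powRr0 2) ler_powR// ler1n.
have g0 : 0 < g by exact: lt_le_trans g1.
have g2 : g ^+ 2 < 1 + P / N.
  rewrite -ltr_ln ?posrE ?exprn_gt0//; last by rewrite addr_gt0// divr_gt0.
  rewrite lnXn// ln_powR.
  move: rC; rewrite /log2 mulrA ltr_pdivlMr// => h.
  rewrite mulr2n; move: h; set u := r * _; set v := ln _ => h; lra.
pose al := P / (P + N).
have PN0 : 0 < P + N by exact: addr_gt0.
have al01 : 0 < al < 1.
  by rewrite divr_gt0//= ltr_pdivrMr// mul1r ltrDl.
(* The slack below capacity: [g ^+ 2 < 1 + P / N] says that the ideal threshold [P N / (P + N)] lies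
   below [P / g ^+ 2]. *)
pose e := P / g ^+ 2 - P * N / (P + N).
have e0 : 0 < e.
  rewrite subr_gt0 ltr_pdivlMr ?exprn_gt0// mulrAC ltr_pdivrMr//.
  rewrite -mulrA ltr_pM2l// -ltr_pdivlMl//.
  by rewrite mulrDr mulVf ?gt_eqF// addrC [_ * P]mulrC.
(* One margin serves both the noise level and the cap; together they raise the threshold by
   [(1 - (1 - al) ^+ 2) * del], which is less than [e]. *)
pose del := e / 3; pose N' := N + del.
have del0 : 0 < del by rewrite divr_gt0.
have N'0 : 0 < N' by exact: addr_gt0.
pose eta := (1 - al) ^+ 2 * P + al ^+ 2 * N' + 2 * al * (1 - al) * del.
have /andP[al0 al1] := al01.
have eta0 : 0 < eta.
  have al1' : 0 < 1 - al by rewrite subr_gt0.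
  apply: addr_gt0; last first.
    exact: (mulr_gt0 (mulr_gt0 (mulr_gt0 (ltr0Sn R 1) al0) al1') del0).
  by apply: addr_gt0; apply: mulr_gt0 => //; exact: exprn_gt0.
have etaE : eta < P / g ^+ 2.
  have -> : eta = P * N / (P + N) + (1 - (1 - al) ^+ 2) * del.
    by rewrite /eta /N' /al; field; rewrite gt_eqF.
  have -> : P / g ^+ 2 = P * N / (P + N) + 3 * del.
    by rewrite /del /e; field; rewrite !gt_eqF.
  rewrite ltrD2l ltr_pM2r//.
  have := sqr_ge0 (1 - al); lra.
pose c2 := Num.sqrt (eta / P).
have c2E : c2 ^+ 2 * P = eta.
  by rewrite sqr_sqrtr ?divfK ?gt_eqF// ltW// divr_gt0.
have c20 : 0 < c2 by rewrite sqrtr_gt0 divr_gt0.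
(* The number of messages is [g ^+ n] and each false alarm costs about [c2 ^+ n]. *)
have gc2 : g * c2 < 1.
  rewrite -(@ltr_pXn2r _ 2) ?nnegrE ?mulr_ge0 ?(ltW g0) ?(ltW c20)//.
  rewrite expr1n exprMn -(ltr_pM2r P0) -mulrA c2E mul1r mulrC.
  by rewrite -ltr_pdivlMr ?exprn_gt0.
have c21 : c2 <= 1.
  by apply: le_trans (ltW gc2); rewrite ler_peMl// ltW.
(* The maximum with [P / 2] keeps the squared radius positive when [del] is large. *)
pose r2 := Num.max (P - del ^+ 2 / N') (P / 2).
have r20 : 0 < r2 by rewrite lt_max [X in _ || X]divr_gt0// orbT.
have r2P : r2 < P.
  by rewrite gt_max gtrBl divr_gt0 ?exprn_gt0//=; lra.
pose c1 := Num.sqrt (r2 / P).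
have c1E : c1 ^+ 2 * P = r2.
  by rewrite sqr_sqrtr ?divfK ?gt_eqF// ltW// divr_gt0.
have c10 : 0 < c1 by rewrite sqrtr_gt0 divr_gt0.
have c11 : c1 < 1.
  by rewrite -sqrtr1 ltr_sqrt// ltr_pdivrMr// mul1r.
have [rho /andP[rho0 rho1] Hrho] := @gauss_tail R sigma L N' s0 (ltW L0) ltac:(by rewrite ltrDl).
move=> eps eps0.
(* Four terms of at most [eps / 8] give [eps / 2], which stays strictly below [eps] after the
   supremum over jammers. *)
have d0 : 0 < eps / 8 by rewrite divr_gt0.
have q01 : 0 <= expR (-1 : R) < 1.
  by rewrite expR_ge0 /= expR_lt1 ltrN10.
have rho01 : 0 <= rho < 1 by rewrite ltW.
have c101 : 0 <= c1 < 1 by rewrite ltW.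
have gc201 : 0 <= g * c2 < 1 by rewrite gc2 mulr_ge0 ?ltW.
have [n1 H1] := expr_eventually_le q01 d0.
have [n2 H2] := expr_eventually_le rho01 d0.
have [n3 H3] := nat_expr_eventually_le c101 d0.
have [n4 H4] := nat_expr_eventually_le gc201 d0.
pose k := (n1 + n2 + n3 + n4).+1.
(* A multiple of the denominator, so that [n * r] is the integer [a * k]. *)
pose n := (b * k)%N.
have kn : (k <= n)%N by rewrite leq_pmull.
have n0 : (0 < n)%N by rewrite muln_gt0 b0.
have h2 : (1 - al) ^+ 2 * P + al ^+ 2 * N' + 2 * al * (1 - al) * del <=
    c2 ^+ 2 * P by rewrite c2E.
have h1 : P - del ^+ 2 / N' <= c1 ^+ 2 * P by rewrite c1E le_max lexx.
have c1P : 0 < c1 <= 1 by rewrite c10 ltW.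
have c2P : 0 < c2 <= 1 by rewrite c20 c21.
have [M [B HB]] := costa_code_error P0 n0 al01 N'0 del0 c1P c2P h2 h1.
pose K := (2 ^ (a * k))%N.
have KE : K%:R = 2 `^ (n%:R * r) :> R.
  rewrite /n /r natrM mulrC mulrA divfK ?pnatr_eq0 -?lt0n//.
  by rewrite -natrM powR_mulrn// natrX.
have KgE : K%:R = g ^+ n by rewrite KE mulrC powRrM powR_mulrn ?powR_ge0.
exists n, K; split => //.
exists (costa_code n M K B al (c2 ^+ 2 * P) (ltW P0)).
apply: (@le_lt_trans _ _ (eps / 2)%:E); last by rewrite lte_fin; lra.
apply: bigmax_le => [|m _]; first exact: leNye.
apply: ge_ereal_sup => _ [Q HQ <-].
pose D := expR (-1) ^+ n + n.+1%:R * c1 ^+ n + K%:R * (n.+1%:R * c2 ^+ n).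
have D0 : 0 <= D.
  by rewrite /D !addr_ge0 ?mulr_ge0 ?exprn_ge0 ?expR_ge0// ltW.
apply: (le_trans (error_prob_le (L := L) (N := N') (D := D) (rho := rho ^+ n)
  sigmaS D0 _ HQ _ _)).
- by rewrite exprn_ge0// ltW.
- exact: Hrho.
- by move=> s j z vN; exact: HB.
rewrite lee_fin /D.
have -> : K%:R * (n.+1%:R * c2 ^+ n) = n.+1%:R * (g * c2) ^+ n.
  by rewrite KgE exprMn mulrCA.
have [/H1 + /H2 + /H3 + /H4] := le4 _ _ _ _ _ kn; clear -eps0; lra.
Qed.

End achievability.

Theorem theorem6 (R : realType) (P L sigma sigmaS : R) (hP : 0 < P)
    (hL : 0 < L) (hsigma : 0 < sigma) (hsigmaS : 0 < sigmaS) :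
  capacity P L sigma sigmaS = (2^-1 * log2 (1 + P / (L + sigma ^+ 2)))%:E.
Proof.
set C := 2^-1 * _.
have C0 : 0 < C.
  rewrite mulr_gt0 ?invr_gt0// divr_gt0 ?ln_gt0 ?ltr1n//.
  by rewrite ltrDl divr_gt0// addr_gt0// exprn_gt0.
apply/eqP; rewrite eq_le; apply/andP; split.
  apply: ge_ereal_sup => _ [r ach <-].
  by rewrite lee_fin; exact: achievable_le_capacity ach.
apply/lee_addgt0Pr => e e0.
(* The maximum with 0 is there because the quotients of natural numbers reach only nonnegative
   rates. *)
have /ratio_between[a [b [b0 /andP[ra rC]]]] : 0 <= Num.max 0 (C - e) < C.
  by rewrite le_max lexx /= gt_max C0 gtrBl.
apply: (@le_trans _ _ ((a%:R / b%:R)%:E + e%:E)%E).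
  by rewrite -EFinD lee_fin -lerBlDr (le_trans _ ra)// le_max lexx orbT.
rewrite leeD2r//; apply: ereal_sup_ubound; exists (a%:R / b%:R) => //.
exact: achievable_ratio.
Qed.
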